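(* Let $G$ be a directed graph with finitely many vertices. Then $C^*(G)$ is residually finite-dimensional if and only if $G$ is finite and no cycle of $G$ has an entry.
   Context: A directed graph $G=(G^0,G^1,s,r)$ consists of countable sets $G^0$ (vertices) and $G^1$ (edges) and maps $s,r:G^1\to G^0$ (source and range); $G$ is finite if both $G^0$ and $G^1$ are finite. The graph C*-algebra $C^*(G)$ is the universal C*-algebra generated by mutually orthogonal projections $p_v$ ($v\in G^0$) and partial isometries $s_e$ ($e\in G^1$) with mutually orthogonal ranges, subject to: (1) $s_e^*s_e=p_{s(e)}$ for each $e\in G^1$; (2) $p_v=\sum_{e\in r^{-1}(v)}s_es_e^*$ for each $v\in G^0$ with $0<\sharp(r^{-1}(v))<\infty$; (3) $s_es_e^*\le p_{r(e)}$ for each $e\in G^1$. A path is a sequence of edges $(\nu_n,\dots,\nu_1)$ with $s(\nu_{i+1})=r(\nu_i)$; a cycle is a path $(\mu_n,\dots,\mu_1)$ with $s(\mu_1)=r(\mu_n)$. ''No cycle has an entry'' means that no edge enters a cycle besides the edges of the cycle itself: for every cycle $\mu$, every edge whose range is a vertex of $\mu$ is one of the edges of $\mu$. A C*-algebra is residually finite-dimensional (RFD) if it has a separating family of finite-dimensional representations. *)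

(* Defs.v *)
From HB Require Import structures.
From mathcomp Require Import all_boot all_order all_algebra.
From mathcomp Require Import complex.
From mathcomp Require Import all_classical all_reals all_analysis.

Set Implicit Arguments.
Unset Strict Implicit.
Unset Printing Implicit Defensive.

Import Order.TTheory GRing.Theory Num.Theory.
Import numFieldNormedType.Exports.

Local Open Scope classical_set_scope.
Local Open Scope ring_scope.

(* The multiplication is not a MathComp ring multiplication because
   C*-algebras need not be unital. The norm takes its values in R[i]; they are
   automatically nonnegative reals. *)
HB.mixin Record isCStarAlgebra (R : realType) A
    of CompleteNormedModule R[i] A := {
  cmul : A -> A -> A ;
  cstar : A -> A ;
  cmulA : forall a b c : A, cmul a (cmul b c) = cmul (cmul a b) c ;
  cmulDl : forall a b c : A, cmul (a + b) c = cmul a c + cmul b c ;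
  cmulDr : forall a b c : A, cmul a (b + c) = cmul a b + cmul a c ;
  cmulZl : forall (k : R[i]) (a b : A), cmul (k *: a) b = k *: cmul a b ;
  cmulZr : forall (k : R[i]) (a b : A), cmul a (k *: b) = k *: cmul a b ;
  cstarK : forall a : A, cstar (cstar a) = a ;
  cstarD : forall a b : A, cstar (a + b) = cstar a + cstar b ;
  cstarZ : forall (k : R[i]) (a : A), cstar (k *: a) = Num.conj k *: cstar a ;
  cstarM : forall a b : A, cstar (cmul a b) = cmul (cstar b) (cstar a) ;
  cnormM : forall a b : A, `|cmul a b| <= `|a| * `|b| ;
  cnorm_star : forall a : A, `|cmul (cstar a) a| = `|a| ^+ 2
}.

#[short(type="cstarAlgType")]
HB.structure Definition CStarAlgebra (R : realType) :=
  { A of isCStarAlgebra R A & CompleteNormedModule R[i] A }.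

Declare Scope cstar_scope.
Delimit Scope cstar_scope with cstar.
Notation "a ** b" := (cmul a b)
  (at level 40, left associativity) : cstar_scope.
Notation "a ^#" := (cstar a) (at level 2, format "a ^#") : cstar_scope.
Local Open Scope cstar_scope.

Definition is_projection (R : realType) (A : cstarAlgType R) (a : A) : Prop :=
  a^# = a /\ a ** a = a.

Definition is_partial_isometry (R : realType) (A : cstarAlgType R) (a : A)
    : Prop :=
  a ** a^# ** a = a.

Definition cpositive (R : realType) (A : cstarAlgType R) (a : A) : Prop :=
  exists c : A, a = c^# ** c.

Definition cle (R : realType) (A : cstarAlgType R) (a b : A) : Prop :=
  cpositive (b - a).

(* No continuity is required: it is automatic. *)
Definition star_hom (R : realType) (A B : cstarAlgType R) (f : A -> B)
    : Prop :=
  [/\ linear f,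
      forall a b, f (a ** b) = f a ** f b &
      forall a, f a^# = (f a)^#].

Definition closed_star_subalgebra (R : realType) (A : cstarAlgType R)
    (S : set A) : Prop :=
  [/\ S 0,
      forall a b, S a -> S b -> S (a + b) /\ S (a ** b),
      forall (k : R[i]) a, S a -> S (k *: a),
      forall a, S a -> S a^# &
      closed S].

(* A representation on the Hilbert space C^n, possibly degenerate. *)
Definition fin_dim_rep (R : realType) (A : cstarAlgType R) (n : nat)
    (f : A -> 'M[R[i]]_n) : Prop :=
  [/\ linear f,
      forall a b, f (a ** b) = f a *m f b &
      forall a, f a^# = map_mx Num.conj (f a)^T].

Definition residually_finite_dim (R : realType) (A : cstarAlgType R) : Prop :=
  exists (I : Type) (n : I -> nat) (f : forall j : I, A -> 'M[R[i]]_(n j)),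
    (forall j, fin_dim_rep (f j)) /\
    (forall a : A, a <> 0 -> exists j, f j a <> 0).

Record digraph : Type := Digraph {
  vertex : countType ;
  edge : countType ;
  src : edge -> vertex ;
  rng : edge -> vertex
}.

Definition finite_digraph (G : digraph) : Prop :=
  finite_set [set: vertex G] /\ finite_set [set: edge G].

(* The path (nu_n, ..., nu_1) is encoded as [:: nu_1; ...; nu_n]. *)
Definition is_path (G : digraph) (nu : seq (edge G)) : Prop :=
  sorted (fun e f => src f == rng e) nu.

Definition is_cycle (G : digraph) (mu : seq (edge G)) : Prop :=
  if mu is e :: mu' then is_path mu /\ src e = rng (last e mu') else False.

Definition path_vertices (G : digraph) (mu : seq (edge G)) : seq (vertex G) :=
  map (@src G) mu ++ map (@rng G) mu.

Definition no_cycle_has_entry (G : digraph) : Prop :=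
  forall mu : seq (edge G), is_cycle mu ->
  forall e : edge G, rng e \in path_vertices mu -> e \in mu.

Record graph_family (R : realType) (G : digraph) (A : cstarAlgType R)
    (p : vertex G -> A) (s : edge G -> A) : Prop := GraphFamily {
  gf_proj : forall v, is_projection (p v) ;
  gf_proj_orth : forall v w, v <> w -> p v ** p w = 0 ;
  gf_pisom : forall e, is_partial_isometry (s e) ;
  gf_range_orth : forall e f, e <> f ->
    (s e ** (s e)^#) ** (s f ** (s f)^#) = 0 ;
  gf_source : forall e, (s e)^# ** s e = p (src e) ;
  gf_sum : forall v,
    [set e | rng e = v] !=set0 -> finite_set [set e | rng e = v] ->
    p v = \sum_(e \in [set e | rng e = v]) (s e ** (s e)^#) ;
  gf_range : forall e, cle (s e ** (s e)^#) (p (rng e))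
}.

(* A, with the families p and s, is the graph C*-algebra of G. These conditions
   determine (A, p, s) up to a unique isomorphism; the homomorphism f below is
   unique by the second condition. *)
Record is_graph_cstar (R : realType) (G : digraph) (A : cstarAlgType R)
    (p : vertex G -> A) (s : edge G -> A) : Prop := IsGraphCStar {
  gc_family : graph_family p s ;
  gc_generated : forall S : set A, closed_star_subalgebra S ->
    (forall v, S (p v)) -> (forall e, S (s e)) -> S = setT ;
  gc_universal : forall (B : cstarAlgType R)
    (q : vertex G -> B) (t : edge G -> B), graph_family q t ->
    exists f : A -> B,
      [/\ star_hom f, forall v, f (p v) = q v & forall e, f (s e) = t e]
}.

(* Main.v *)
From HB Require Import structures.
Require Import Defs.
From mathcomp Require Import all_boot all_order all_algebra all_field all_solvable.
From mathcomp Require Import complex.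
From mathcomp Require Import all_classical all_reals all_analysis.
From mathcomp Require Import ring lra.

(** Suppose first that finite-dimensional representations separate the points
    of the graph algebra. In such a representation the projections of the two
    ends of an edge have comparable traces: the projection of the source has the
    trace of the range projection of the edge, which lies below the projection
    of the range vertex. Infinitely many edges out of one vertex w would give
    infinitely many orthogonal projections of the same trace, so the projection
    of w would vanish ([rep_infinite_emitter_eq0]). Around a cycle all the
    traces agree, so every edge of the cycle exhausts the vertex it enters, and
    an entry would be killed together with its source ([rep_cycle_entry_eq0]).
    Both contradict the fact that no vertex projection of a graph algebra is
    zero ([graph_proj_neq0]). That fact needs a model, and the model must be
    infinite-dimensional: the C*-algebra of bounded operators on l^2, where the
    Cuntz--Krieger relations are realized by partial bijections of the natural
    numbers ([branching_family]).

    Conversely, let the graph be finite with no entries to cycles. Walking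
    backwards from any vertex ends at a terminal vertex, that is, a source or a
    vertex of a cycle. Stopping the backward paths there gives a finite index
    set, and letting every edge carry a phase z on the circle gives a family of
    finite-dimensional representations ([phase_rep]). They separate points. A
    nonzero element a stays nonzero after multiplication by a suitable word that
    ends at a terminal vertex w ([walk_to_terminal]), so it is enough to treat a
    nonzero element of the corner at w. The monomials span a dense subspace, and
    in the corner they become Laurent polynomials in the unitary that moves one
    step around the cycles, whose values on the circle are matrix coefficients
    of the phase representations ([word_corner], [laurent_corner]). The norm of
    a polynomial in a unitary is at most its supremum on the circle
    ([norm_peval_circle]), so an element of the corner that all the phase
    representations kill is a limit of elements whose norms tend to 0.

    The last step uses that homomorphisms of C*-algebras are contractive. This
    is proved without spectral theory ([star_hom_contractive]): for self-adjoint
    h of norm less than 1 the element h + i sqrt (1 - h^2) is unitary, and the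
    square root is a limit of polynomials in h. *)

Set Implicit Arguments.
Unset Strict Implicit.
Unset Printing Implicit Defensive.

Import Order.TTheory GRing.Theory Num.Theory.
Import numFieldNormedType.Exports.

Local Open Scope classical_set_scope.
Local Open Scope ring_scope.
Local Open Scope cstar_scope.

(** * Estimates in C*-algebras *)

Section NormedModules.
Variables (R : realType).
Implicit Types (X : completeNormedModType R[i]).

(** The order on the complex numbers is partial, so limits of inequalities
    between norms are taken through these two lemmas instead of a linear order. *)
Lemma norm_small_eq0 (X : normedModType R[i]) (K : R[i]) (x : X) : 0 <= K ->
  (forall e, 0 < e -> `|x| <= K * e) -> x = 0.
Proof.
move=> K0 H; apply/eqP; rewrite -normr_eq0; apply/negPn/negP => x0.
have xp : 0 < `|x| by rewrite lt_def x0 normr_ge0.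
have K1 : 0 < K + 1 by rewrite ltr_wpDl.
have := H (`|x| / 2 / (K + 1)) _; rewrite !divr_gt0 // => /(_ isT).
rewrite mulrA mulrAC => h.
have : `|x| <= `|x| / 2.
  apply: le_trans h _; rewrite mulrC ler_piMr ?divr_ge0 //.
  by rewrite ler_pdivrMr // mul1r lerDl ler01.
rewrite -subr_le0 -[X in X - _]mulr1 -mulrBr pmulr_rle0 //.
by rewrite subr_le0 lt_geF // invf_lt1 ?ltr1n.
Qed.

Lemma ler_add_small (a b : R[i]) : 0 <= a -> 0 <= b ->
  (forall e, 0 < e -> a <= b + e) -> a <= b.
Proof.
move=> a0 b0 H.
have ar : a = (complex.Re a)%:C%C by rewrite RRe_real // ger0_real.
have br : b = (complex.Re b)%:C%C by rewrite RRe_real // ger0_real.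
rewrite ar br lecR; apply/ler_addgt0Pl => e e0.
by rewrite -lecR rmorphD /= -ar -br addrC H // (ltcR 0).
Qed.

Lemma expr_small (r e : R[i]) : 0 <= r -> r < 1 -> 0 < e ->
  exists N : nat, forall n, (N <= n)%N -> r ^+ n < e.
Proof.
move=> r0 r1 e0.
have er : r = (complex.Re r)%:C%C by rewrite RRe_real // ger0_real.
have ee : e = (complex.Re e)%:C%C by rewrite RRe_real // gtr0_real.
move: r0 r1 e0; rewrite er ee; set s := complex.Re r; set d := complex.Re e.
rewrite ler0c (ltcR 0) (ltcR s 1) => s0 s1 d0.
have /cvgrPdist_lt /(_ d d0) [N _ HN] : s ^+ n @[n --> \oo] --> 0.
  by apply: cvg_expr; rewrite ger0_norm.
exists N => n /HN /=; rewrite sub0r normrN ger0_norm ?exprn_ge0 //.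
by rewrite -rmorphXn /= ltcR.
Qed.

(** The limit is returned in epsilon form because it is only used to pass
    algebraic identities and norm bounds to the limit. *)
Lemma geometric_increments_cvg X (u : nat -> X) (r : R[i]) : 0 <= r -> r < 1 ->
  (forall n, `|u n.+1 - u n| <= r ^+ n) ->
  exists l, forall e, 0 < e -> exists N, forall n, (N <= n)%N -> `|l - u n| < e.
Proof.
move=> r0 r1 hu.
have r1' : 0 < 1 - r by rewrite subr_gt0.
have dist n m : `|u (n + m)%N - u n| <= r ^+ n * (1 - r ^+ m) / (1 - r).
  elim: m => [|m IH]; first by rewrite addn0 subrr normr0 expr0 subrr mulr0 mul0r.
  rewrite addnS; have -> : u (n + m).+1%N - u n =
     (u (n + m).+1%N - u (n + m)%N) + (u (n + m)%N - u n) by rewrite addrA subrK.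
  apply: le_trans (ler_normD _ _) _; apply: le_trans (lerD (hu _) IH) _.
  rewrite -[X in X + _](mulfK (lt0r_neq0 r1')) -mulrDl ler_wpM2r ?invr_ge0 ?(ltW r1') //.
  by rewrite exprD -mulrA -mulrDr exprS mulrBr mulr1 [_ * r]mulrC addrC addrA subrK.
have : cvg (u n @[n --> \oo]).
  apply: cauchy_cvg; apply: cauchy_exP => e e0.
  have e1 : 0 < e * (1 - r) by rewrite mulr_gt0.
  have [N HN] := expr_small r0 r1 e1.
  exists (u N); exists N => // n /= Nn; rewrite -ball_normE /= distrC -(subnKC Nn).
  apply: le_lt_trans (dist _ _) _; rewrite ltr_pdivrMr //.
  apply: le_lt_trans (HN N (leqnn N)); rewrite ler_piMr ?exprn_ge0 //.
  by rewrite lerBlDr lerDl exprn_ge0.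
move=> /cvg_ex [l /cvgrPdist_lt hl]; exists l => e /hl [N _ HN].
by exists N => n /HN.
Qed.

Lemma closed_approx (X : normedModType R[i]) (S : set X) :
  (forall a, (forall e : R[i], 0 < e -> exists2 b, S b & `|a - b| < e) -> S a) ->
  closed S.
Proof.
move=> H a clS; apply: H => e e0.
have [b [Sb]] := clS (ball a e) (nbhsx_ballx a e e0).
by rewrite -ball_normE /= => ab; exists b.
Qed.

Lemma closureP (X : normedModType R[i]) (S : set X) (a : X) :
  closure S a <-> forall e : R[i], 0 < e -> exists2 b, S b & `|a - b| < e.
Proof.
split=> [clS e e0 | H B].
  have [b [Sb]] := clS (ball a e) (nbhsx_ballx a e e0).
  by rewrite -ball_normE /= => ab; exists b.
rewrite -nbhs_ballE => -[e e0 eB]; have [b Sb ab] := H e e0.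
by exists b; split => //; apply: eB; rewrite -ball_normE.
Qed.

(** A point that is within e of the centre of every ball of radius e that
    belongs to a Cauchy filter is its limit. The two completeness proofs below
    construct such a point from pointwise limits. *)
Lemma cauchy_ball_limit (X : normedModType R[i]) (F : set_system X) (l : X) :
  ProperFilter F -> cauchy F ->
  (forall T e, 0 < e -> F (ball T e) -> `|T - l| <= e) -> cvg F.
Proof.
move=> FF Fc Hl; apply/cvg_ex; exists l; apply/cvgrPdist_lt => e e0.
have e3 : 0 < e / 3 by rewrite divr_gt0.
have [T FT] := (cauchyP _).1 Fc _ e3.
apply: filterS (FT) => S; rewrite -ball_normE /= => TS.
rewrite -(subrK T l) -addrA; apply: le_lt_trans (ler_normD _ _) _.
have LT : `|l - T| <= e / 3 by rewrite distrC; exact: Hl.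
apply: (@le_lt_trans _ _ (e / 3 + e / 3)); first by rewrite lerD // ltW.
have n3 : (3 : R[i]) != 0 by rewrite pnatr_eq0.
by rewrite -[ltRHS](divfK n3) -mulr2n -[ltLHS]mulr_natr ltr_pM2l // ltr_nat.
Qed.

End NormedModules.

Section CStarBasics.
Variables (R : realType) (A : cstarAlgType R).
Implicit Types a b c : A.

Lemma cmul0l a : 0 ** a = 0.
Proof. by apply: (addrI (0 ** a)); rewrite -cmulDl !addr0. Qed.
Lemma cmul0r a : a ** 0 = 0.
Proof. by apply: (addrI (a ** 0)); rewrite -cmulDr !addr0. Qed.
Lemma cmulNl a b : (- a) ** b = - (a ** b).
Proof. by rewrite -scaleN1r cmulZl scaleN1r. Qed.
Lemma cmulNr a b : a ** (- b) = - (a ** b).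
Proof. by rewrite -scaleN1r cmulZr scaleN1r. Qed.
Lemma cmulBl a b c : (a - b) ** c = a ** c - b ** c.
Proof. by rewrite cmulDl cmulNl. Qed.
Lemma cmulBr a b c : a ** (b - c) = a ** b - a ** c.
Proof. by rewrite cmulDr cmulNr. Qed.
Lemma cmul_suml I (s : seq I) (P : pred I) (F : I -> A) b :
  (\sum_(i <- s | P i) F i) ** b = \sum_(i <- s | P i) (F i ** b).
Proof. by apply: (big_morph (fun x => x ** b)) => [x y|]; rewrite (cmulDl, cmul0l). Qed.
Lemma cmul_sumr I (s : seq I) (P : pred I) (F : I -> A) b :
  b ** (\sum_(i <- s | P i) F i) = \sum_(i <- s | P i) (b ** F i).
Proof. by apply: (big_morph (fun x => b ** x)) => [x y|]; rewrite (cmulDr, cmul0r). Qed.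

Lemma cstar0 : (0 : A)^# = 0.
Proof. by apply: (addrI ((0 : A)^#)); rewrite -cstarD !addr0. Qed.
Lemma cstarN a : (- a)^# = - a^#.
Proof. by apply: (addrI (a^#)); rewrite -cstarD !subrr cstar0. Qed.
Lemma cstarB a b : (a - b)^# = a^# - b^#.
Proof. by rewrite cstarD cstarN. Qed.
Lemma cstar_sum I (s : seq I) (P : pred I) (F : I -> A) :
  (\sum_(i <- s | P i) F i)^# = \sum_(i <- s | P i) (F i)^#.
Proof. by apply: (big_morph (@cstar R A)) => [x y|]; rewrite (cstarD, cstar0). Qed.

Lemma cnorm_cstar a : `|a^#| = `|a|.
Proof.
have le x : `|x| <= `|x^# : A|.
  have [->|x0] := eqVneq x 0; first by rewrite normr0 normr_ge0.
  have xp : 0 < `|x| by rewrite normr_gt0.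
  by rewrite -(ler_pM2r xp) -expr2 -cnorm_star cnormM.
by apply/eqP; rewrite eq_le le andbT -{2}(cstarK a) le.
Qed.

Lemma norm_projection_le1 a : is_projection a -> `|a| <= 1.
Proof.
move=> [ass aa]; have [->|a0] := eqVneq a 0; first by rewrite normr0.
have ap : 0 < `|a| by rewrite normr_gt0.
by rewrite -(ler_pM2l ap) mulr1 -expr2 -cnorm_star ass aa.
Qed.

Lemma cstar_mul_eq0 a : a^# ** a = 0 -> a = 0.
Proof.
by move=> h; apply/eqP; rewrite -normr_eq0 -sqrf_eq0 -cnorm_star h normr0.
Qed.

(** The equation says that g = 1 - sqrt (1 - h^2), without mentioning a unit.
    The iteration g <- (g^2 + h^2) / 2 is a contraction on the ball of radius
    |h|, and it preserves self-adjoint elements that commute with h. *)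
Lemma one_minus_sqrt_exists (h : A) : h^# = h -> `|h| < 1 ->
  exists g : A, [/\ g^# = g, g ** h = h ** g & g + g = g ** g + h ** h].
Proof.
move=> hs h1; set r := `|h| in h1; have r0 : 0 <= r by rewrite normr_ge0.
(* F maps the ball of radius r into itself and has Lipschitz constant r on it. *)
pose F (x : A) := 2^-1 *: (x ** x + h ** h); pose u n := iter n F 0.
have two0 : (0 : R[i]) < 2 by rewrite ltr0n.
have n2 : `|(2^-1 : R[i])| = 2^-1 by rewrite ger0_norm // invr_ge0 ltW.
have ub n : `|u n| <= r.
  elim: n => [|n IH]; first by rewrite normr0.
  rewrite /u iterS -/(u n) normrZ n2 mulrC ler_pdivrMr //.
  apply: le_trans (ler_normD _ _) _; rewrite mulr_natr mulr2n.
  apply: lerD; apply: le_trans (cnormM _ _) _.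
    by apply: le_trans (ler_piMr r0 (ltW h1)); rewrite ler_pM.
  by rewrite ler_piMr // ltW.
have us n : (u n)^# = u n.
  elim: n => [|n IH]; first by rewrite cstar0.
  rewrite /u iterS -/(u n) cstarZ cstarD !cstarM IH hs.
  by congr (_ *: _); rewrite fmorphV rmorph_nat.
have uc n : u n ** h = h ** u n.
  elim: n => [|n IH]; first by rewrite cmul0l cmul0r.
  rewrite /u iterS -/(u n) cmulZl cmulZr cmulDl cmulDr; congr (_ *: (_ + _)).
    by rewrite -cmulA IH cmulA IH cmulA.
  by rewrite cmulA.
have Flip x y : `|x| <= r -> `|y| <= r -> `|F x - F y| <= r * `|x - y|.
  move=> xr yr; rewrite /F -scalerBr normrZ n2 mulrC ler_pdivrMr //.
  rewrite opprD addrACA subrr addr0.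
  have -> : x ** x - y ** y = x ** (x - y) + (x - y) ** y.
    by rewrite cmulBr cmulBl addrA subrK.
  apply: le_trans (ler_normD _ _) _; rewrite mulr_natr mulr2n.
  apply: lerD; apply: le_trans (cnormM _ _) _.
    by rewrite ler_wpM2r ?normr_ge0.
  by rewrite mulrC ler_wpM2r ?normr_ge0.
have inc n : `|u n.+1 - u n| <= r ^+ n.
  elim: n => [|n IH].
    rewrite expr0 subr0; exact: le_trans (ub 1%N) (ltW h1).
  rewrite exprS; change (`|F (u n.+1) - F (u n)| <= r * r ^+ n).
  apply: le_trans (Flip _ _ (ub _) (ub _)) _.
  by rewrite ler_wpM2l.
have [g hg] := geometric_increments_cvg r0 h1 inc.
have appr e : 0 < e -> exists n, `|g - u n| < e /\ `|g - u n.+1| < e.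
  by move=> /hg[N HN]; exists N; split; apply: HN.
have gr : `|g| <= r.
  apply: ler_add_small => // e e0; have [n [H _]] := appr e e0.
  rewrite -(subrK (u n) g) [r + e]addrC; apply: le_trans (ler_normD _ _) _.
  by apply: lerD; [exact: ltW | exact: ub].
exists g; split.
- apply/eqP; rewrite -subr_eq0; apply/eqP; apply: (@norm_small_eq0 _ _ 2) => // e.
  move=> /appr [n [H _]].
  have -> : g^# - g = (g - u n)^# - (g - u n) by rewrite cstarB us opprB addrA subrK.
  apply: le_trans (ler_normB _ _) _; rewrite cnorm_cstar mulr_natl mulr2n.
  by rewrite lerD // ltW.
- apply/eqP; rewrite -subr_eq0; apply/eqP; apply: (@norm_small_eq0 _ _ 2) => // e.
  move=> /appr [n [H _]].
  have -> : g ** h - h ** g = (g - u n) ** h - h ** (g - u n).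
    by rewrite cmulBl cmulBr uc opprB addrA subrK.
  apply: le_trans (ler_normB _ _) _; rewrite mulr_natl mulr2n.
  have k : `|g - u n| * r <= e.
    by apply: le_trans (ltW H); rewrite ler_piMr // ltW.
  by apply: lerD; apply: le_trans (cnormM _ _) _ => //; rewrite mulrC.
- suff : g = F g.
    move=> e; rewrite {1 2}e /F -scalerDl.
    have -> : 2^-1 + 2^-1 = 1 :> R[i]; last by rewrite scale1r.
    by rewrite -mulr2n -[LHS]mulr_natl mulfV // lt0r_neq0.
  apply/eqP; rewrite -subr_eq0; apply/eqP; apply: (@norm_small_eq0 _ _ 2) => // e.
  move=> /appr [n [H1 H2]].
  have -> : g - F g = (g - u n.+1) + (F (u n) - F g) by rewrite addrA subrK.
  apply: le_trans (ler_normD _ _) _; rewrite mulr_natl mulr2n.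
  apply: lerD; first exact: ltW.
  apply: le_trans (Flip _ _ (ub _) gr) _; rewrite distrC; apply: le_trans (ltW H1).
  by rewrite ler_piMl // ltW.
Qed.

End CStarBasics.

(** * Homomorphisms are contractive *)

Section StarHom.
Variables (R : realType) (A B : cstarAlgType R) (f : A -> B).
Hypothesis hf : star_hom f.

Lemma star_homD a b : f (a + b) = f a + f b.
Proof. by case: hf => lf _ _; have := lf 1 a b; rewrite !scale1r. Qed.
Lemma star_hom0 : f 0 = 0.
Proof. by apply: (addrI (f 0)); rewrite -star_homD !addr0. Qed.
Lemma star_homZ k a : f (k *: a) = k *: f a.
Proof. by case: hf => lf _ _; have := lf k a 0; rewrite star_hom0 !addr0. Qed.
Lemma star_homB a b : f (a - b) = f a - f b.
Proof. by rewrite star_homD -scaleN1r star_homZ scaleN1r. Qed.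
Lemma star_homM a b : f (a ** b) = f a ** f b.
Proof. by case: hf. Qed.
Lemma star_homS a : f a^# = (f a)^#.
Proof. by case: hf. Qed.
End StarHom.

(** The reason is that x + i (1 - y) is unitary: its real part x then has
    norm at most 1. Acting on the elements b of the algebra replaces the
    missing unit. *)
Lemma unitary_real_part_le1 (R : realType) (B : cstarAlgType R) (x y : B) :
  x^# = x -> y^# = y -> y ** x = x ** y -> y + y = y ** y + x ** x ->
  `|x| <= 1.
Proof.
move=> xs ys xy e.
have iso (k : R[i]) b : Num.conj k = - k -> k * Num.conj k = 1 ->
    `|x ** b + k *: (b - y ** b)| = `|b|.
  move=> kc k1; apply/eqP; rewrite -(eqrXn2 (n:=2)) // -!cnorm_star.
  apply/eqP; congr (`| _ |); set c := b - y ** b.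
  have cs : c^# = b^# - b^# ** y by rewrite cstarB cstarM ys.
  rewrite cstarD cstarZ cstarM xs cmulDl !cmulDr !cmulZl !cmulZr scalerA.
  rewrite [Num.conj k * k]mulrC k1 scale1r kc.
  have -> : c^# ** (x ** b) = b^# ** x ** c.
    by rewrite cs /c cmulBl cmulBr !cmulA -!(cmulA b^#) xy.
  rewrite addrACA scaleNr addrAC -!addrA [k *: _ + _]addrA [k *: _ + _]addrC addrK.
  have -> : c^# ** c = b^# ** b - b^# ** (y + y) ** b + b^# ** (y ** y) ** b.
    rewrite cs /c cmulBl !cmulBr cmulDr cmulDl !cmulA !opprD opprK !addrA.
    by [].
  rewrite e [b^# ** (_ + _)]cmulDr cmulDl opprD !cmulA addrC -!addrA.
  by rewrite [X in _ + (_ + (_ + X))]addrC addKr addNr addr0.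
have xb b : `|x ** b| <= `|b|.
  have ic : Num.conj 'i = - 'i :> R[i] := conjCi _.
  have i2 : 'i * - 'i = 1 :> R[i] by rewrite mulrN -expr2 sqrCi opprK.
  have h1 : `|x ** b + 'i *: (b - y ** b)| = `|b| by apply: iso; rewrite ic.
  have h2 : `|x ** b + (- 'i) *: (b - y ** b)| = `|b|.
    by apply: iso; rewrite -ic conjCK ?ic ?opprK // mulrC.
  have e2 : (x ** b) *+ 2 = (x ** b + 'i *: (b - y ** b)) + (x ** b + (- 'i) *: (b - y ** b)).
    by rewrite addrACA scaleNr addrN addr0 mulr2n.
  rewrite -(ler_pMn2r (n := 2)) // -normrMn e2.
  apply: le_trans (ler_normD _ _) _.
  by rewrite h1 h2 -mulr2n.
have [->|x0] := eqVneq x 0; first by rewrite normr0.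
rewrite -(ler_pM2r (x := `|x|)) ?normr_gt0 // mul1r -expr2 -cnorm_star xs.
exact: xb.
Qed.

(** A homomorphism carries the identities between h and g = 1 - sqrt (1 - h^2)
    to its target whether or not it is continuous, which bounds f h for
    self-adjoint h; the C*-identity reduces the general case to this one. *)
Lemma star_hom_contractive (R : realType) (A B : cstarAlgType R) (f : A -> B) :
  star_hom f -> forall a, `|f a| <= `|a|.
Proof.
move=> hf.
have lt1 h : h^# = h -> `|h| < 1 -> `|f h| <= 1.
  move=> hs h1; have [g [gs gc ge]] := one_minus_sqrt_exists hs h1.
  apply: (@unitary_real_part_le1 _ _ _ (f g)).
  - by rewrite -star_homS // hs.
  - by rewrite -star_homS // gs.
  - by rewrite -!star_homM // gc.
  - by rewrite -!star_homM // -!star_homD // ge.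
move=> a; have [->|a0] := eqVneq a 0; first by rewrite star_hom0 // normr0.
rewrite -(ler_pXn2r (n := 2)) // ?nnegrE // -!cnorm_star -star_homS // -star_homM //.
set h := a^# ** a; have hs : h^# = h by rewrite /h cstarM cstarK.
have hp : 0 < `|h|.
  by rewrite /h cnorm_star exprn_gt0 // normr_gt0.
apply: ler_add_small => // e e0; rewrite [`|h| + e]addrC.
set d : R[i] := _ + `|h|; have d0 : 0 < d by rewrite addr_gt0.
have dn : `|d^-1| = d^-1 by rewrite ger0_norm // invr_ge0 ltW.
have : `|f (d^-1 *: h)| <= 1.
  apply: lt1; last by rewrite normrZ dn mulrC ltr_pdivrMr // mul1r ltrDr.
  by rewrite cstarZ hs -[in RHS]dn -[in LHS]dn; congr (_ *: _); rewrite conj_normC.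
by rewrite star_homZ // normrZ dn mulrC ler_pdivrMr // mul1r.
Qed.

(** * Hilbert spaces and their bounded operators *)

Section PreHilbert.
Variables (R : realType) (V : lmodType R[i]) (ip : V -> V -> R[i]).
Hypothesis ipPl : forall k x y z, ip (k *: x + y) z = k * ip x z + ip y z.
Hypothesis ipC : forall x y, ip y x = Num.conj (ip x y).
Hypothesis ip_pos : forall x, x != 0 -> 0 < ip x x.
Implicit Types x y z : V.

Lemma ipDl x y z : ip (x + y) z = ip x z + ip y z.
Proof. by have := ipPl 1 x y z; rewrite scale1r mul1r. Qed.
Lemma ip0l z : ip 0 z = 0.
Proof. by apply: (addrI (ip 0 z)); rewrite -ipDl !addr0. Qed.
Lemma ipZl k x z : ip (k *: x) z = k * ip x z.
Proof. by have := ipPl k x 0 z; rewrite ip0l !addr0. Qed.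
Lemma ipBl x y z : ip (x - y) z = ip x z - ip y z.
Proof. by rewrite ipDl -scaleN1r ipZl mulN1r. Qed.
Lemma ipDr x y z : ip z (x + y) = ip z x + ip z y.
Proof. by rewrite ipC ipDl rmorphD /= -!ipC. Qed.
Lemma ip0r z : ip z 0 = 0.
Proof. by rewrite ipC ip0l rmorph0. Qed.
Lemma ipZr k x z : ip z (k *: x) = Num.conj k * ip z x.
Proof. by rewrite ipC ipZl rmorphM /= -ipC. Qed.
Lemma ipBr x y z : ip z (x - y) = ip z x - ip z y.
Proof. by rewrite ipC ipBl rmorphB /= -!ipC. Qed.

Lemma ip_ge0 x : 0 <= ip x x.
Proof. by have [->|/ip_pos/ltW //] := eqVneq x 0; rewrite ip0l. Qed.

Definition ipnorm x := sqrtC (ip x x).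

Lemma ipnorm_ge0 x : 0 <= ipnorm x.
Proof. by rewrite sqrtC_ge0 ip_ge0. Qed.

Lemma ip_cauchy_schwarz x y : `|ip x y| <= ipnorm x * ipnorm y.
Proof.
have [->|/ip_pos yp] := eqVneq y 0.
  by rewrite ip0r normr0 mulr_ge0 // ipnorm_ge0.
set c := ip x y; set n := ip y y in yp *.
have : 0 <= ip (n *: x - c *: y) (n *: x - c *: y) by exact: ip_ge0.
have nc : Num.conj n = n by rewrite geC0_conj // ltW.
rewrite ipBl !ipBr !ipZl !ipZr nc -/c [ip y x]ipC -/c -/n.
rewrite [Num.conj c * n]mulrC subrr subr0 -mulrBr pmulr_rge0 // subr_ge0.
rewrite [_ * c]mulrC -normCK => h.
rewrite -(ler_pXn2r (n := 2)) ?nnegrE ?mulr_ge0 ?ipnorm_ge0 //.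
by rewrite exprMn !sqrtCK mulrC.
Qed.

Lemma ipnormD x y : ipnorm (x + y) <= ipnorm x + ipnorm y.
Proof.
rewrite -(ler_pXn2r (n := 2)) ?nnegrE ?addr_ge0 ?ipnorm_ge0 //.
rewrite sqrtCK ipDl !ipDr sqrrD !sqrtCK addrA lerD2r -addrA lerD2l.
have real_sum : ip x y + ip y x \is Num.real.
  by rewrite CrealE rmorphD /= -!ipC addrC.
apply: le_trans (real_ler_norm real_sum) _; apply: le_trans (ler_normD _ _) _.
have := ip_cauchy_schwarz y x; have := ip_cauchy_schwarz x y.
by rewrite [ipnorm y * _]mulrC mulr2n; exact: lerD.
Qed.

Lemma ipnormZ k x : ipnorm (k *: x) = `|k| * ipnorm x.
Proof.
rewrite /ipnorm ipZl ipZr mulrA -normCK sqrtCM ?nnegrE ?exprn_ge0 ?ip_ge0 //.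
by rewrite sqrCK.
Qed.

Lemma ipnorm_eq0 x : ipnorm x = 0 -> x = 0.
Proof.
move=> /eqP; rewrite sqrtC_eq0 => h.
by have [//|/ip_pos] := eqVneq x 0; rewrite lt_def h.
Qed.

End PreHilbert.

HB.mixin Record isHilbert (R : realType) H of CompleteNormedModule R[i] H := {
  hip : H -> H -> R[i] ;
  hipPl : forall (k : R[i]) (x y z : H), hip (k *: x + y) z = k * hip x z + hip y z ;
  hipC : forall x y : H, hip y x = Num.conj (hip x y) ;
  hip_norm : forall x : H, hip x x = `|x| ^+ 2
}.

#[short(type="hilbertType")]
HB.structure Definition Hilbert (R : realType) :=
  { H of isHilbert R H & CompleteNormedModule R[i] H }.

Section InnerProduct.
Variables (R : realType) (H : hilbertType R).
Implicit Types x y z : H.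

Lemma hipBl x y z : hip (x - y) z = hip x z - hip y z.
Proof. exact: ipBl hipPl _ _ _. Qed.
Lemma hipBr x y z : hip z (x - y) = hip z x - hip z y.
Proof. exact: ipBr hipPl hipC _ _ _. Qed.
Lemma hipDl x y z : hip (x + y) z = hip x z + hip y z.
Proof. exact: ipDl hipPl _ _ _. Qed.
Lemma hipDr x y z : hip z (x + y) = hip z x + hip z y.
Proof. exact: ipDr hipPl hipC _ _ _. Qed.
Lemma hip0l z : hip (0 : H) z = 0.
Proof. exact: ip0l hipPl _. Qed.
Lemma hip0r z : hip z (0 : H) = 0.
Proof. exact: ip0r hipPl hipC _. Qed.
Lemma hipZl k x z : hip (k *: x) z = k * hip x z.
Proof. exact: ipZl hipPl _ _ _. Qed.
Lemma hipZr k x z : hip z (k *: x) = Num.conj k * hip z x.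
Proof. exact: ipZr hipPl hipC _ _ _. Qed.

Lemma hip_pos x : x != 0 -> 0 < hip x x.
Proof. by move=> x0; rewrite hip_norm exprn_gt0 // normr_gt0. Qed.

Lemma hip_eq0 x : (forall z, hip x z = 0) -> x = 0.
Proof.
by move=> /(_ x)/eqP; rewrite hip_norm sqrf_eq0 normr_eq0 => /eqP.
Qed.

Lemma cauchy_schwarz x y : `|hip x y| <= `|x| * `|y|.
Proof.
by have := ip_cauchy_schwarz hipPl hipC hip_pos x y; rewrite /ipnorm !hip_norm !sqrCK.
Qed.

End InnerProduct.

(** Bounded operators are stored with their adjoint: the involution is then
    a swap, and linearity and uniqueness of the adjoint are consequences. *)
Record bop (R : realType) (H : hilbertType R) := Bop {
  bfun :> H -> H ;
  badj : H -> H ;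
  badjP : forall x y, hip (bfun x) y = hip x (badj y) ;
  bbound : exists M : R, 0 <= M /\ forall x, `|bfun x| <= M%:C%C * `|x|
}.

HB.instance Definition _ (R : realType) (H : hilbertType R) :=
  gen_eqMixin (bop H).
HB.instance Definition _ (R : realType) (H : hilbertType R) :=
  gen_choiceMixin (bop H).

Section BoundedOperators.
Variables (R : realType) (H : hilbertType R).
Implicit Types S T : bop H.

Lemma bop_ext S T : (forall x, S x = T x) -> S = T.
Proof.
case: S T => f f' fP fb [g g' gP gb] /= fg.
have {fg} eg : f = g by apply: funext.
subst g; have {}eg : f' = g'.
  apply: funext => y; apply/eqP; rewrite -subr_eq0; apply/eqP/hip_eq0 => z.
  by rewrite hipBl (hipC z) (hipC z (g' y)) -fP -gP subrr.
subst g'; congr Bop; exact: Prop_irrelevance.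
Qed.

Lemma hip_adjr T x y : hip x (T y) = hip (badj T x) y.
Proof. by rewrite hipC badjP -hipC. Qed.

Lemma bop_linear T k x y : T (k *: x + y) = k *: T x + T y.
Proof.
apply/eqP; rewrite -subr_eq0; apply/eqP/hip_eq0 => z.
by rewrite hipBl hipPl !badjP hipPl subrr.
Qed.
Lemma bopfD T x y : T (x + y) = T x + T y.
Proof. by have := bop_linear T 1 x y; rewrite !scale1r. Qed.
Lemma bopf0 T : T 0 = 0.
Proof. by apply: (addrI (T 0)); rewrite -bopfD !addr0. Qed.
Lemma bopfZ T k x : T (k *: x) = k *: T x.
Proof. by have := bop_linear T k x 0; rewrite bopf0 !addr0. Qed.
(** The bounds are taken among the real numbers, where infima exist. *)
Definition opnorm_bounds T : set R :=
  [set M | 0 <= M /\ forall x, `|T x| <= M%:C%C * `|x|].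
Definition opnorm T : R[i] := (inf (opnorm_bounds T))%:C%C.

Lemma opnorm_ge0 T : 0 <= opnorm T.
Proof.
by rewrite ler0c; apply: lb_le_inf => [|M []]; first exact: bbound T.
Qed.

Lemma opnormP T x : `|T x| <= opnorm T * `|x|.
Proof.
have [->|x0] := eqVneq x 0; first by rewrite bopf0 !normr0 mulr0.
have xp : 0 < `|x| by rewrite normr_gt0.
rewrite -ler_pdivrMr //.
have q0 : 0 <= `|T x| / `|x| by rewrite divr_ge0.
have -> : `|T x| / `|x| = (complex.Re (`|T x| / `|x|))%:C%C.
  by rewrite RRe_real // ger0_real.
rewrite lecR; apply: lb_le_inf => [|M [M0 HM]]; first exact: bbound T.
rewrite -lecR RRe_real ?ger0_real // ler_pdivrMr //.
Qed.

Lemma opnorm_le T (c : R[i]) : 0 <= c -> (forall x, `|T x| <= c * `|x|) ->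
  opnorm T <= c.
Proof.
move=> c0; have -> : c = (complex.Re c)%:C%C by rewrite RRe_real // ger0_real.
move=> Hc; rewrite lecR; apply: ge_inf; first by exists 0 => M [].
by split => //; rewrite -ler0c RRe_real ?ger0_real.
Qed.

Lemma badj_bound T x : `|badj T x| <= opnorm T * `|x|.
Proof.
have [->|x0] := eqVneq (badj T x) 0.
  by rewrite normr0 mulr_ge0 // opnorm_ge0.
have xp : 0 < `|badj T x| by rewrite normr_gt0.
rewrite -(ler_pM2r xp) -expr2 -hip_norm -hip_adjr -(ger0_norm (x := hip _ _)).
  apply: le_trans (cauchy_schwarz _ _) _.
  by rewrite [opnorm T * _]mulrC -mulrA ler_wpM2l // opnormP.
by rewrite hip_adjr hip_norm exprn_ge0.
Qed.

Program Definition bop_star T : bop H := @Bop R H (badj T) T _ _.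
Next Obligation. by move=> T x y; rewrite hip_adjr. Qed.
Next Obligation.
move=> T; exists (inf (opnorm_bounds T)); rewrite -ler0c.
by split; [exact: opnorm_ge0 | exact: badj_bound].
Qed.

Lemma bop_bound_ex (f : H -> H) (c : R[i]) : 0 <= c ->
  (forall x, `|f x| <= c * `|x|) ->
  exists M : R, 0 <= M /\ forall x, `|f x| <= M%:C%C * `|x|.
Proof.
move=> c0 hc; exists (complex.Re c); rewrite -ler0c RRe_real ?ger0_real //.
Qed.

Program Definition bop0 : bop H := @Bop R H (fun=> 0) (fun=> 0) _ _.
Next Obligation. by move=> x y; rewrite hip0l hip0r. Qed.
Next Obligation.
by apply: (@bop_bound_ex _ 0) => // x; rewrite normr0 mul0r.
Qed.

Program Definition bopD S T : bop H :=
  @Bop R H (fun x => S x + T x) (fun x => badj S x + badj T x) _ _.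
Next Obligation. by move=> S T x y; rewrite hipDl hipDr !badjP. Qed.
Next Obligation.
move=> S T; apply: (@bop_bound_ex _ (opnorm S + opnorm T)) => [|x].
  by rewrite addr_ge0 // opnorm_ge0.
by rewrite mulrDl; apply: le_trans (ler_normD _ _) _; rewrite lerD // opnormP.
Qed.

Program Definition bopZ (k : R[i]) T : bop H :=
  @Bop R H (fun x => k *: T x) (fun x => Num.conj k *: badj T x) _ _.
Next Obligation. by move=> k T x y; rewrite hipZl hipZr badjP conjCK. Qed.
Next Obligation.
move=> k T; apply: (@bop_bound_ex _ (`|k| * opnorm T)) => [|x].
  by rewrite mulr_ge0 // opnorm_ge0.
by rewrite normrZ -mulrA ler_wpM2l // opnormP.
Qed.

Program Definition bopM S T : bop H :=
  @Bop R H (fun x => S (T x)) (fun x => badj T (badj S x)) _ _.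
Next Obligation. by move=> S T x y; rewrite !badjP. Qed.
Next Obligation.
move=> S T; apply: (@bop_bound_ex _ (opnorm S * opnorm T)) => [|x].
  by rewrite mulr_ge0 // opnorm_ge0.
apply: le_trans (opnormP S (T x)) _; rewrite -mulrA ler_wpM2l ?opnorm_ge0 //.
exact: opnormP.
Qed.

Fact bop_addrA : associative bopD.
Proof. by move=> S T U; apply: bop_ext => x /=; rewrite addrA. Qed.
Fact bop_addrC : commutative bopD.
Proof. by move=> S T; apply: bop_ext => x /=; rewrite addrC. Qed.
Fact bop_add0r : left_id bop0 bopD.
Proof. by move=> S; apply: bop_ext => x /=; rewrite add0r. Qed.
Fact bop_addNr : left_inverse bop0 (bopZ (-1)) bopD.
Proof. by move=> S; apply: bop_ext => x /=; rewrite scaleN1r addNr. Qed.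

HB.instance Definition _ :=
  GRing.isZmodule.Build (bop H) bop_addrA bop_addrC bop_add0r bop_addNr.

Lemma bopDE S T x : (S + T) x = S x + T x. Proof. by []. Qed.
Fact bop_scalerA (a b : R[i]) T : bopZ a (bopZ b T) = bopZ (a * b) T.
Proof. by apply: bop_ext => x /=; rewrite scalerA. Qed.
Fact bop_scale1r : left_id 1 bopZ.
Proof. by move=> S; apply: bop_ext => x /=; rewrite scale1r. Qed.
Fact bop_scalerDr : right_distributive bopZ +%R.
Proof. by move=> k S T; apply: bop_ext => x /=; rewrite scalerDr. Qed.
Fact bop_scalerDl T : {morph bopZ^~ T : a b / a + b}.
Proof. by move=> k l; apply: bop_ext => x /=; rewrite scalerDl. Qed.

HB.instance Definition _ := GRing.Zmodule_isLmodule.Build R[i] (bop H)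
  bop_scalerA bop_scale1r bop_scalerDr bop_scalerDl.

Lemma bopZE k T x : (k *: T) x = k *: T x. Proof. by []. Qed.
Lemma bopBE S T x : (S - T) x = S x - T x.
Proof. by rewrite bopDE -scaleN1r bopZE scaleN1r. Qed.

Fact opnormD S T : opnorm (S + T) <= opnorm S + opnorm T.
Proof.
apply: opnorm_le => [|x]; first by rewrite addr_ge0 // opnorm_ge0.
by rewrite mulrDl; apply: le_trans (ler_normD _ _) _; rewrite lerD // opnormP.
Qed.
Fact opnormZ k T : opnorm (k *: T) = `|k| * opnorm T.
Proof.
have le l U : opnorm (l *: U) <= `|l| * opnorm U.
  apply: opnorm_le => [|x]; first by rewrite mulr_ge0 // opnorm_ge0.
  by rewrite normrZ -mulrA ler_wpM2l // opnormP.
apply/eqP; rewrite eq_le le /=.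
have [->|k0] := eqVneq k 0; first by rewrite normr0 mul0r opnorm_ge0.
have kp : 0 < `|k| by rewrite normr_gt0.
rewrite -ler_pdivlMl // -normfV; apply: le_trans (le _ _).
by rewrite scalerA mulVf // scale1r.
Qed.
Fact opnorm_eq0 T : opnorm T = 0 -> T = 0.
Proof.
move=> e; apply: bop_ext => x; apply/eqP; rewrite -normr_eq0 eq_le normr_ge0 andbT.
by have := opnormP T x; rewrite e mul0r.
Qed.

HB.instance Definition _ :=
  Lmodule_isNormed.Build R[i] (bop H) opnormD opnormZ opnorm_eq0.

Lemma bopN T x : `|T x| <= `|T| * `|x|.
Proof. exact: opnormP. Qed.
Lemma bopN_le T (c : R[i]) : 0 <= c -> (forall x, `|T x| <= c * `|x|) -> `|T| <= c.
Proof. exact: opnorm_le. Qed.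
Lemma badjN T x : `|badj T x| <= `|T| * `|x|.
Proof. exact: badj_bound. Qed.

Lemma badjB S T x : badj (S - T) x = badj S x - badj T x.
Proof.
by rewrite /= rmorphN rmorph1 scaleN1r.
Qed.

(** The evaluation [ev] is that of the operators or that of their adjoints; the
    limits of both together form the limit operator. *)
Lemma pointwise_limit (F : set_system (bop H)) (ev : bop H -> H -> H) :
  ProperFilter F -> cauchy F ->
  (forall S T x, `|ev S x - ev T x| <= `|S - T| * `|x|) ->
  exists L : H -> H, forall e T, 0 < e -> F (ball T e) ->
    forall x, `|ev T x - L x| <= e * `|x|.
Proof.
move=> FF /cauchyP Fc Lip.
have cv x : cvg ((fun T => ev T x) @ F).
  apply: cauchy_cvg; apply: cauchy_exP => e e0.
  have x1 : 0 < `|x| + 1 by rewrite ltr_wpDl.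
  have [T FT] := Fc _ (divr_gt0 e0 x1).
  exists (ev T x); suff : F [set S | ball (ev T x) e (ev S x)] by [].
  apply: filterS FT => S; rewrite /= -!ball_normE /= => TS.
  apply: le_lt_trans (Lip _ _ _) _.
  apply: (@le_lt_trans _ _ (`|T - S| * (`|x| + 1))).
    by rewrite ler_wpM2l // lerDl.
  by rewrite -ltr_pdivlMr.
exists (fun x => lim ((fun T => ev T x) @ F)) => e T e0 FT x.
apply: ler_add_small => //; first by rewrite mulr_ge0 // ltW.
move=> d d0; have /cvgrPdist_lt /(_ d d0) near1 := cv x.
have [S [TS Sd]] : exists S, (ball T e `&`
    [set S | `|lim (ev S x @[S --> F]) - ev S x| < d]) S.
  by apply: (@filter_ex _ F); apply: filterI.
rewrite -(subrK (ev S x) (ev T x)) -addrA; apply: le_trans (ler_normD _ _) _.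
apply: lerD; last by rewrite distrC ltW.
apply: le_trans (Lip _ _ _) _; rewrite ler_wpM2r //.
by move: TS; rewrite -ball_normE /= => /ltW.
Qed.

Fact bop_complete (F : set_system (bop H)) : ProperFilter F -> cauchy F -> cvg F.
Proof.
move=> FF Fc.
have [|L HL] := pointwise_limit FF Fc (ev := @bfun R H).
  by move=> S T x; rewrite -bopBE bopN.
have [|L' HL'] := pointwise_limit FF Fc (ev := @badj R H).
  by move=> S T x; rewrite -badjB badjN.
have LP x y : hip (L x) y = hip x (L' y).
  apply/eqP; rewrite -subr_eq0; apply/eqP.
  apply: (@norm_small_eq0 R R[i]^o (2 * (`|x| * `|y|))); first by rewrite !mulr_ge0.
  move=> e e0; have [T FT] := (cauchyP _).1 Fc e e0.
  have -> : hip (L x) y - hip x (L' y) = hip x (badj T y - L' y) - hip (T x - L x) y.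
    by rewrite hipBl hipBr badjP opprB [RHS]addrC addrA subrK.
  apply: le_trans (ler_normB _ _) _; rewrite -mulrA mulr_natl mulr2n.
  apply: lerD; apply: le_trans (cauchy_schwarz _ _) _.
    by rewrite -mulrA ler_wpM2l // mulrC; exact: HL'.
  by rewrite mulrAC ler_wpM2r // mulrC; exact: HL.
have Lb : exists M : R, 0 <= M /\ forall x, `|L x| <= M%:C%C * `|x|.
  have [T FT] := (cauchyP _).1 Fc 1 ltr01.
  apply: (@bop_bound_ex _ (`|T| + 1)) => [|x]; first by rewrite addr_ge0.
  rewrite -[L x](subKr (T x)) mulrDl; apply: le_trans (ler_normB _ _) _.
  by apply: lerD; [exact: bopN | exact: HL].
apply: (cauchy_ball_limit (l := Bop LP Lb)) => // T e e0 FT.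
by apply: bopN_le => [|x]; [exact: ltW | rewrite bopBE; exact: HL].
Qed.

HB.instance Definition _ := Uniform_isComplete.Build (bop H) bop_complete.

Lemma bop_cnormM S T : `|bopM S T| <= `|S| * `|T|.
Proof.
apply: bopN_le => [|x]; first by rewrite mulr_ge0.
apply: le_trans (bopN S (T x)) _; rewrite -mulrA ler_wpM2l //; exact: bopN.
Qed.

Lemma bop_norm_star T : `|bop_star T| <= `|T|.
Proof. by apply: bopN_le => // x; exact: badjN. Qed.

(** The inequality that matters is |T x|^2 = (T* T x, x) <= |T* T| |x|^2. *)
Lemma bop_cnorm_star T : `|bopM (bop_star T) T| = `|T| ^+ 2.
Proof.
set S := bopM _ _.
apply/eqP; rewrite eq_le; apply/andP; split.
  apply: le_trans (bop_cnormM _ _) _; rewrite expr2 ler_wpM2r //.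
  exact: bop_norm_star.
have S0 : 0 <= `|S| by [].
rewrite -(sqrtCK `|S|) ler_pXn2r ?nnegrE ?sqrtC_ge0 //.
apply: bopN_le => [|x]; first by rewrite sqrtC_ge0.
rewrite -(ler_pXn2r (n := 2)) ?nnegrE ?mulr_ge0 ?sqrtC_ge0 //.
rewrite exprMn sqrtCK -hip_norm badjP.
have -> : badj T (T x) = S x by [].
rewrite -[X in X <= _]ger0_norm; last first.
  by rewrite -(badjP T) hip_norm exprn_ge0.
apply: le_trans (cauchy_schwarz _ _) _.
rewrite mulrC expr2 mulrA ler_wpM2r //; exact: bopN.
Qed.

Fact bop_cmulA S T U : bopM S (bopM T U) = bopM (bopM S T) U.
Proof. exact: bop_ext. Qed.
Fact bop_cmulDl S T U : bopM (S + T) U = bopM S U + bopM T U.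
Proof. exact: bop_ext. Qed.
Fact bop_cmulDr S T U : bopM S (T + U) = bopM S T + bopM S U.
Proof. by apply: bop_ext => x /=; rewrite bopfD. Qed.
Fact bop_cmulZl k S T : bopM (k *: S) T = k *: bopM S T.
Proof. exact: bop_ext. Qed.
Fact bop_cmulZr k S T : bopM S (k *: T) = k *: bopM S T.
Proof. by apply: bop_ext => x /=; rewrite bopfZ. Qed.
Fact bop_cstarK T : bop_star (bop_star T) = T.
Proof. exact: bop_ext. Qed.
Fact bop_cstarD S T : bop_star (S + T) = bop_star S + bop_star T.
Proof. exact: bop_ext. Qed.
Fact bop_cstarZ k T : bop_star (k *: T) = Num.conj k *: bop_star T.
Proof. exact: bop_ext. Qed.
Fact bop_cstarM S T : bop_star (bopM S T) = bopM (bop_star T) (bop_star S).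
Proof. exact: bop_ext. Qed.

HB.instance Definition _ := isCStarAlgebra.Build R (bop H)
  bop_cmulA bop_cmulDl bop_cmulDr bop_cmulZl bop_cmulZr bop_cstarK
  bop_cstarD bop_cstarZ bop_cstarM bop_cnormM bop_cnorm_star.

Lemma bopME S T x : bfun (S ** T) x = S (T x). Proof. by []. Qed.
Lemma bop_hip_star T x y : hip (T x) y = hip x (bfun (T^#) y).
Proof. exact: badjP. Qed.

End BoundedOperators.

(** * Square-summable sequences *)

Section RealSeries.
Variable R : realType.
Implicit Types a b c : nat -> R.

Lemma cvg_series_lin a b c (x y : R) : cvgn (series a) -> cvgn (series b) ->
  cvgn (series c) ->
  series (fun i => x * a i + y * b i + c i) n @[n --> \oo] -->
    x * limn (series a) + y * limn (series b) + limn (series c).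
Proof.
move=> ca cb cc.
have -> : series (fun i => x * a i + y * b i + c i) =
    (fun n => x * series a n + y * series b n + series c n).
  apply: funext => n; rewrite /series /= !mulr_sumr -!big_split /=.
  by apply: eq_bigr.
by apply: cvgD => //; apply: cvgD; apply: cvgM => //; exact: cvg_cst.
Qed.

Lemma cvg_series_nonneg_bounded a (M : R) : (forall k, 0 <= a k) ->
  (forall n, series a n <= M) -> cvgn (series a).
Proof.
move=> a0 aM; apply: nondecreasing_is_cvgn; last by exists M => _ [n _ <-].
by apply/nondecreasing_seqP => n; rewrite /series /= big_nat_recr //= lerDl.
Qed.

Lemma series_le_limn a n : (forall k, 0 <= a k) -> cvgn (series a) ->
  series a n <= limn (series a).
Proof.
move=> a0 ca; apply: nondecreasing_cvgn_le => //.
by apply/nondecreasing_seqP => m; rewrite /series /= big_nat_recr //= lerDl.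
Qed.

End RealSeries.

Section SquareSummable.
Variable R : realType.
Implicit Types (f g : nat -> R[i]).

Definition sqn (z : R[i]) : R := complex.Re z ^+ 2 + complex.Im z ^+ 2.

Lemma sqn_ge0 z : 0 <= sqn z.
Proof. by rewrite addr_ge0 // sqr_ge0. Qed.

Lemma sqnE z : (sqn z)%:C%C = `|z| ^+ 2.
Proof. exact: add_Re2_Im2. Qed.

Definition square_summable f := cvgn (series (fun k => sqn (f k))).

Lemma square_summableP f :
  square_summable f <-> exists M, forall n, series (fun k => sqn (f k)) n <= M.
Proof.
split=> [cf|[M HM]].
  exists (limn (series (fun k => sqn (f k)))) => n.
  by apply: series_le_limn => // k; exact: sqn_ge0.
by apply: (cvg_series_nonneg_bounded (M := M)) => // k; exact: sqn_ge0.
Qed.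

Lemma square_summable_lin (k : R[i]) f g : square_summable f ->
  square_summable g -> square_summable (fun i => k * f i + g i).
Proof.
move=> /square_summableP [M HM] /square_summableP [N HN]; apply/square_summableP.
exists (2 * sqn k * M + 2 * N) => n.
apply: le_trans (lerD (ler_wpM2l _ (HM n)) (ler_wpM2l _ (HN n))) => //.
  rewrite /series /= !mulr_sumr -big_split /=; apply: ler_sum => i _.
  have -> : 2 * sqn k * sqn (f i) = 2 * sqn (k * f i).
    by case: k (f i) => [a b] [c d]; rewrite /sqn /=; ring.
  case: (k * f i) (g i) => [a b] [c d]; rewrite /sqn /=.
  by have := sqr_ge0 (a - c); have := sqr_ge0 (b - d); nra.
by rewrite mulr_ge0 ?sqn_ge0.
Qed.

Lemma cvg_series_dominated (a : nat -> R) f g : square_summable f ->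
  square_summable g -> (forall k, `|a k| <= sqn (f k) + sqn (g k)) ->
  cvgn (series a).
Proof.
move=> cf cg le; apply: (@normed_cvg R R^o).
apply: (series_le_cvg (v_ := fun k => sqn (f k) + sqn (g k))).
- by move=> k /=.
- by move=> k; rewrite addr_ge0 ?sqn_ge0.
- by [].
exact: (is_cvg_seriesD cf cg).
Qed.

(** Sums are formed in each component, where the completeness of the real
    numbers is available. *)
Definition csum (a : nat -> R[i]) : R[i] :=
  (limn (series (fun k => complex.Re (a k)))
   +i* limn (series (fun k => complex.Im (a k))))%C.

Definition csummable (a : nat -> R[i]) :=
  cvgn (series (fun k => complex.Re (a k))) /\
  cvgn (series (fun k => complex.Im (a k))).

Lemma csum_lin (k : R[i]) (a b : nat -> R[i]) : csummable a -> csummable b ->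
  csum (fun i => k * a i + b i) = k * csum a + csum b.
Proof.
case: k => x y [ca ca'] [cb cb'].
have e1 : (fun i => complex.Re ((x +i* y)%C * a i + b i)) =
    (fun i => x * complex.Re (a i) + (- y) * complex.Im (a i) + complex.Re (b i)).
  by apply: funext => i; case: (a i) (b i) => [? ?] [? ?] /=; rewrite mulNr.
have e2 : (fun i => complex.Im ((x +i* y)%C * a i + b i)) =
    (fun i => x * complex.Im (a i) + y * complex.Re (a i) + complex.Im (b i)).
  by apply: funext => i; case: (a i) (b i) => [? ?] [? ?] /=.
rewrite /csum e1 e2.
rewrite (cvg_lim _ (cvg_series_lin (x := x) (y := - y) ca ca' cb)) //.
rewrite (cvg_lim _ (cvg_series_lin (x := x) (y := y) ca' ca cb')) //.
by apply/eqP; rewrite eq_complex /= mulNr !eqxx.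
Qed.

Lemma csum_conj a : csummable a ->
  csum (fun i => Num.conj (a i)) = Num.conj (csum a).
Proof.
move=> [ca ca']; rewrite /csum.
have -> : (fun k => complex.Re (Num.conj (a k))) = (fun k => complex.Re (a k)).
  by apply: funext => k; case: (a k).
have -> : (fun k => complex.Im (Num.conj (a k))) = - (fun k => complex.Im (a k)).
  apply: funext => k; change (complex.Im (Num.conj (a k)) = - complex.Im (a k)).
  by case: (a k).
by rewrite lim_seriesN.
Qed.

Lemma csummable_prod f g : square_summable f -> square_summable g ->
  csummable (fun i => f i * Num.conj (g i)).
Proof.
move=> cf cg; split; apply: (cvg_series_dominated cf cg) => k;
  case: (f k) (g k) => [a b] [c d] /=; rewrite /sqn /=.
  have := sqr_ge0 (a + c); have := sqr_ge0 (a - c).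
  have := sqr_ge0 (b + d); have := sqr_ge0 (b - d).
  have := sqr_ge0 a; have := sqr_ge0 b; have := sqr_ge0 c; have := sqr_ge0 d.
  by rewrite ler_norml; move=> *; apply/andP; split; nra.
have := sqr_ge0 (a + d); have := sqr_ge0 (a - d).
have := sqr_ge0 (b + c); have := sqr_ge0 (b - c).
have := sqr_ge0 a; have := sqr_ge0 b; have := sqr_ge0 c; have := sqr_ge0 d.
by rewrite ler_norml; move=> *; apply/andP; split; nra.
Qed.

Lemma csum_sqn f : csum (fun i => f i * Num.conj (f i)) =
  (limn (series (fun k => sqn (f k))))%:C%C.
Proof.
rewrite /csum.
have -> : (fun k => complex.Re (f k * Num.conj (f k))) = (fun k => sqn (f k)).
  by apply: funext => k; case: (f k) => a b; rewrite /sqn /=; ring.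
have -> : (fun k => complex.Im (f k * Num.conj (f k))) = (fun k => 0).
  by apply: funext => k; case: (f k) => a b /=; ring.
have -> : series (fun=> 0 : R) = (fun=> 0).
  by apply: funext => n; rewrite /series /= big1.
by rewrite lim_cst.
Qed.

Lemma csum_single (k : nat) (a : nat -> R[i]) : (forall i, i != k -> a i = 0) ->
  csum a = a k.
Proof.
move=> a0.
have H (h : R[i] -> R) : h 0 = 0 -> limn (series (fun i => h (a i))) = h (a k).
  move=> h0; apply: cvg_lim => //; apply: cvg_near_cst.
  exists k.+1 => // n /= kn; rewrite /series /= (bigD1_seq k) ?iota_uniq //=.
    by rewrite big1 ?addr0 // => i /a0 ->.
  by rewrite mem_index_iota.
by rewrite /csum (H (@complex.Re R)) // (H (@complex.Im R)) //; case: (a k).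
Qed.

End SquareSummable.

(** * The Hilbert space of square-summable sequences *)

Record ell2 (R : realType) := Ell2 {
  coord2 :> nat -> R[i] ;
  coord2P : square_summable coord2
}.
Arguments coord2P {R} e.

HB.instance Definition _ (R : realType) := gen_eqMixin (ell2 R).
HB.instance Definition _ (R : realType) := gen_choiceMixin (ell2 R).

Section Ell2.
Variable R : realType.
Local Notation H := (ell2 R).
Implicit Types x y z : H.

Lemma ell2_ext x y : (forall i, x i = y i) -> x = y.
Proof.
case: x y => f fP [g gP] /= fg; have {fg} e : f = g by apply: funext.
by subst g; congr Ell2; exact: Prop_irrelevance.
Qed.

Fact square_summable0 : square_summable (fun=> 0 : R[i]).
Proof.
apply/square_summableP; exists 0 => n; rewrite /series /= big1 // => i _.
by rewrite /sqn /= expr0n addr0.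
Qed.

Definition ell2_0 : H := Ell2 square_summable0.
Definition ell2_lin (k : R[i]) x y : H :=
  Ell2 (square_summable_lin (k := k) (coord2P x) (coord2P y)).
Definition ell2_add x y : H := ell2_lin 1 x y.
Definition ell2_scale (k : R[i]) x : H := ell2_lin k x ell2_0.

Fact ell2_addE x y i : ell2_add x y i = x i + y i.
Proof. by rewrite /= mul1r. Qed.
Fact ell2_scaleE k x i : ell2_scale k x i = k * x i.
Proof. by rewrite /= addr0. Qed.

Fact ell2_addA : associative ell2_add.
Proof. by move=> x y z; apply: ell2_ext => i; rewrite !ell2_addE addrA. Qed.
Fact ell2_addC : commutative ell2_add.
Proof. by move=> x y; apply: ell2_ext => i; rewrite !ell2_addE addrC. Qed.
Fact ell2_add0 : left_id ell2_0 ell2_add.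
Proof. by move=> x; apply: ell2_ext => i; rewrite !ell2_addE add0r. Qed.
Fact ell2_addN : left_inverse ell2_0 (ell2_scale (-1)) ell2_add.
Proof.
by move=> x; apply: ell2_ext => i; rewrite ell2_addE ell2_scaleE mulN1r addNr.
Qed.

HB.instance Definition _ :=
  GRing.isZmodule.Build H ell2_addA ell2_addC ell2_add0 ell2_addN.

Fact ell2_scaleA a b x : ell2_scale a (ell2_scale b x) = ell2_scale (a * b) x.
Proof. by apply: ell2_ext => i; rewrite !ell2_scaleE mulrA. Qed.
Fact ell2_scale1 : left_id 1 ell2_scale.
Proof. by move=> x; apply: ell2_ext => i; rewrite ell2_scaleE mul1r. Qed.
Fact ell2_scaleDr : right_distributive ell2_scale +%R.
Proof.
move=> k x y; apply: ell2_ext => i.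
by rewrite !(ell2_scaleE, ell2_addE) mulrDr.
Qed.
Fact ell2_scaleDl x : {morph ell2_scale^~ x : a b / a + b}.
Proof.
move=> k l; apply: ell2_ext => i.
by rewrite !(ell2_scaleE, ell2_addE) mulrDl.
Qed.

HB.instance Definition _ := GRing.Zmodule_isLmodule.Build R[i] H
  ell2_scaleA ell2_scale1 ell2_scaleDr ell2_scaleDl.

Lemma coordD x y i : (x + y) i = x i + y i. Proof. exact: ell2_addE. Qed.
Lemma coordZ k x i : (k *: x) i = k * x i. Proof. exact: ell2_scaleE. Qed.
Lemma coord0 i : (0 : H) i = 0. Proof. by []. Qed.
Lemma coordB x y i : (x - y) i = x i - y i.
Proof. by rewrite coordD -scaleN1r coordZ mulN1r. Qed.
Global Arguments coord2 {R} e i : simpl never.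

Lemma coord_sum I (s : seq I) (F : I -> H) i :
  (\sum_(j <- s) F j) i = \sum_(j <- s) F j i.
Proof. by apply: (big_morph (fun x : H => x i)) => [x y|]; rewrite ?coordD ?coord0. Qed.

Definition ell2_ip x y : R[i] := csum (fun i => x i * Num.conj (y i)).

Fact ell2_ipPl k x y z :
  ell2_ip (k *: x + y) z = k * ell2_ip x z + ell2_ip y z.
Proof.
rewrite /ell2_ip -csum_lin; try exact: csummable_prod (coord2P _) (coord2P _).
by congr csum; apply: funext => i; rewrite coordD coordZ mulrDl mulrA.
Qed.

Fact ell2_ipC x y : ell2_ip y x = Num.conj (ell2_ip x y).
Proof.
rewrite /ell2_ip -csum_conj; last exact: csummable_prod (coord2P _) (coord2P _).
by congr csum; apply: funext => i; rewrite rmorphM /= conjCK mulrC.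
Qed.

Lemma ell2_ip_sqn x :
  ell2_ip x x = (limn (series (fun k => sqn (x k))))%:C%C.
Proof. exact: csum_sqn. Qed.

Lemma ell2_partial_le x n :
  (series (fun k => sqn (x k)) n)%:C%C <= ell2_ip x x.
Proof.
rewrite ell2_ip_sqn lecR; apply: series_le_limn; last exact: coord2P.
by move=> k; exact: sqn_ge0.
Qed.

Lemma ell2_ip_le x (c : R) : (forall n, series (fun k => sqn (x k)) n <= c) ->
  ell2_ip x x <= c%:C%C.
Proof.
move=> h; rewrite ell2_ip_sqn lecR; apply: limr_le; first exact: coord2P.
exact: nearW.
Qed.

Lemma ell2_coord_le x k : `|x k| ^+ 2 <= ell2_ip x x.
Proof.
apply: le_trans (ell2_partial_le x k.+1); rewrite -sqnE lecR.
by rewrite /series /= big_nat_recr //= lerDr sumr_ge0 // => i _; exact: sqn_ge0.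
Qed.

Fact ell2_ip_pos x : x != 0 -> 0 < ell2_ip x x.
Proof.
move=> x0; have [k xk] : exists k, x k != 0.
  apply/not_existsP => h; move/eqP: x0; apply; apply: ell2_ext => k.
  by have /negP := h k; rewrite negbK => /eqP.
by apply: lt_le_trans (ell2_coord_le x k); rewrite exprn_gt0 // normr_gt0.
Qed.

HB.instance Definition _ := Lmodule_isNormed.Build R[i] H
  (ipnormD ell2_ipPl ell2_ipC ell2_ip_pos)
  (ipnormZ ell2_ipPl ell2_ipC ell2_ip_pos) (ipnorm_eq0 ell2_ip_pos).

Lemma ell2_ip_norm x : ell2_ip x x = `|x| ^+ 2.
Proof. by rewrite sqrtCK. Qed.

Lemma ell2_coord_norm x k : `|x k| <= `|x|.
Proof.
by rewrite -(ler_pXn2r (n := 2)) ?nnegrE // -ell2_ip_norm ell2_coord_le.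
Qed.

End Ell2.

Section Ell2Complete.
Variable R : realType.
Local Notation H := (ell2 R).
Implicit Types x y z : H.

Lemma sqnB (z w : R[i]) : sqn (z - w) =
  (complex.Re z - complex.Re w) * (complex.Re z - complex.Re w) +
  (complex.Im z - complex.Im w) * (complex.Im z - complex.Im w).
Proof. by case: z w => [? ?] [? ?]; rewrite /sqn /= !expr2. Qed.

Lemma cauchy_coord_cvg (F : set_system H) (h : R[i] -> R) (i : nat) :
  ProperFilter F -> cauchy F -> (forall z w : R[i], h (z - w) = h z - h w) ->
  (forall z : R[i], (`|h z|)%:C%C <= `|z|) -> cvg ((fun x : H => h (x i)) @ F).
Proof.
move=> FF /cauchyP Fc hB hle; apply: cauchy_cvg; apply: cauchy_exP => e e0.
have [|T FT] := Fc e%:C%C; first by rewrite (ltcR 0).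
exists (h (T i)); suff : F [set x : H | ball (h (T i)) e (h (x i))] by [].
apply: filterS FT => x; rewrite -!ball_normE /= => Tx.
rewrite -ltcR; apply: le_lt_trans Tx; rewrite -hB -coordB.
by apply: le_trans (hle _) _; exact: ell2_coord_norm.
Qed.

Fact ell2_complete (F : set_system H) : ProperFilter F -> cauchy F -> cvg F.
Proof.
move=> FF Fc.
have cRe i : cvg ((fun x : H => complex.Re (x i)) @ F).
  apply: cauchy_coord_cvg => // [z w|z]; last exact: normc_ge_Re.
  by case: z w => [? ?] [? ?].
have cIm i : cvg ((fun x : H => complex.Im (x i)) @ F).
  apply: cauchy_coord_cvg => // [z w|z]; first by case: z w => [? ?] [? ?].
  have -> : complex.Im z = - complex.Re (z * 'i%C) by rewrite ReiNIm opprK.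
  rewrite normrN; apply: le_trans (normc_ge_Re _) _; rewrite normrM.
  have -> : `|'i%C : R[i]| = 1; last by rewrite mulr1.
  by rewrite normc_def /= expr0n expr1n add0r sqrtr1.
pose l i := (lim ((fun x : H => complex.Re (x i)) @ F)
             +i* lim ((fun x : H => complex.Im (x i)) @ F))%C.
(* A bound on partial sums involves finitely many coordinates only, so it
   passes to the coordinatewise limit l. *)
have part (T : H) (e : R) n : 0 < e -> F (ball T e%:C%C) ->
    series (fun k => sqn (T k - l k)) n <= e ^+ 2.
  move=> e0 FT.
  apply: (@cvgr_to_le _ F _ R (fun x : H => series (fun k => sqn (T k - x k)) n)).
    elim: n => [|n IH].
      have -> : (fun x : H => series (fun k => sqn (T k - x k)) 0) = (fun=> 0).
        by apply: funext => x; rewrite /series /= big_nil.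
      by rewrite /series /= big_nil; exact: cvg_cst.
    have -> : (fun x : H => series (fun k => sqn (T k - x k)) n.+1) =
       (fun x : H => series (fun k => sqn (T k - x k)) n +
         ((complex.Re (T n) - complex.Re (x n)) * (complex.Re (T n) - complex.Re (x n)) +
          (complex.Im (T n) - complex.Im (x n)) * (complex.Im (T n) - complex.Im (x n)))).
      by apply: funext => x; rewrite /series /= big_nat_recr //= sqnB.
    have -> : series (fun k => sqn (T k - l k)) n.+1 =
        series (fun k => sqn (T k - l k)) n +
         ((complex.Re (T n) - complex.Re (l n)) * (complex.Re (T n) - complex.Re (l n)) +
          (complex.Im (T n) - complex.Im (l n)) * (complex.Im (T n) - complex.Im (l n))).
      by rewrite -sqnB; apply: big_nat_recr.
    apply: cvgD => //; apply: cvgD; apply: cvgM; apply: cvgB;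
      first [exact: cvg_cst | exact: cRe | exact: cIm].
  apply: filterS FT => x; rewrite -ball_normE /= => Tx.
  rewrite -lecR; apply: (@le_trans _ _ (ell2_ip (T - x) (T - x))).
    apply: le_trans (ell2_partial_le _ n); rewrite lecR le_eqVlt; apply/orP; left.
    by apply/eqP; apply: eq_bigr => k _; rewrite coordB.
  by rewrite ell2_ip_norm rmorphXn /= ler_pXn2r ?nnegrE ?ler0c ?(ltW e0) ?(ltW Tx).
have lP : square_summable l.
  have [T FT] := (cauchyP _).1 Fc 1 ltr01.
  have dP : square_summable (fun k => T k - l k).
    by apply/square_summableP; exists (1 ^+ 2) => n; apply: part.
  have -> : l = (fun i => -1 * (T i - l i) + T i).
    by apply: funext => i; rewrite mulN1r opprB subrK.
  exact: square_summable_lin dP (coord2P T).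
apply: (cauchy_ball_limit (l := Ell2 lP)) => // T e e0.
have -> : e = (complex.Re e)%:C%C by rewrite RRe_real // gtr0_real.
have e0' : 0 < complex.Re e by rewrite -(ltcR 0) RRe_real // gtr0_real.
move=> FT; rewrite -(ler_pXn2r (n := 2)) ?nnegrE ?ler0c ?(ltW e0') //.
rewrite -ell2_ip_norm -rmorphXn /=; apply: ell2_ip_le => n.
rewrite (_ : series _ n = series (fun k => sqn (T k - l k)) n) ?part //.
by apply: eq_bigr => k _; rewrite coordB.
Qed.

HB.instance Definition _ := Uniform_isComplete.Build H ell2_complete.
HB.instance Definition _ := isHilbert.Build R H
  (@ell2_ipPl R) (@ell2_ipC R) (@ell2_ip_norm R).

Fact square_summable_basis (k : nat) :
  square_summable (fun i => (i == k)%:R : R[i]).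
Proof.
apply/square_summableP; exists 1 => n; rewrite /series /=.
have [kn|nk] := ltnP k n.
  rewrite (bigD1_seq k) ?iota_uniq ?mem_index_iota //= eqxx big1 => [|i /negbTE ->].
    by rewrite addr0 /sqn /= expr1n expr0n addr0.
  by rewrite /sqn /= expr0n addr0.
rewrite big_nat big1 ?ler01 // => i /andP[_ ik].
rewrite (_ : (i == k) = false) ?/sqn /= ?expr0n ?addr0 //.
by apply/negbTE; rewrite neq_ltn (leq_trans ik nk).
Qed.

Definition basis2 (k : nat) : H := Ell2 (@square_summable_basis k).

Lemma basis2E k i : basis2 k i = (i == k)%:R. Proof. by []. Qed.

Lemma hip_basis2 x k : hip x (basis2 k) = x k.
Proof.
rewrite /hip /= /ell2_ip (csum_single (k := k)).
  by rewrite basis2E eqxx conjC1 mulr1.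
by move=> i /negbTE ik; rewrite basis2E ik rmorph0 mulr0.
Qed.

Lemma basis2_hip x k : hip (basis2 k) x = Num.conj (x k).
Proof. by rewrite hipC hip_basis2. Qed.

Lemma norm_basis2 k : `|basis2 k| = 1.
Proof.
apply/eqP; rewrite -(eqrXn2 (n := 2)) // -hip_norm hip_basis2 basis2E eqxx.
by rewrite expr1n.
Qed.

Definition trunc2 n x : H := \sum_(k <- index_iota 0 n) x k *: basis2 k.

Lemma trunc2E n x i : trunc2 n x i = if (i < n)%N then x i else 0.
Proof.
rewrite coord_sum; case: ltnP => ni.
  rewrite (bigD1_seq i) ?iota_uniq ?mem_index_iota // coordZ basis2E eqxx mulr1.
  rewrite big1 => [|k ki]; first exact: addr0.
  by rewrite coordZ basis2E eq_sym (negbTE ki) mulr0.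
rewrite big_nat big1 // => k /andP[_ kn]; rewrite coordZ basis2E.
by rewrite (_ : (i == k) = false) ?mulr0 // gtn_eqF // (leq_trans kn ni).
Qed.

Lemma trunc2_dense x e : 0 < e -> exists n, `|x - trunc2 n x| < e.
Proof.
move=> e0.
have er : e = (complex.Re e)%:C%C by rewrite RRe_real // gtr0_real.
move: e0; rewrite er; set d := complex.Re e; rewrite (ltcR 0) => d0.
have d2 : 0 < (d / 2) ^+ 2 by rewrite exprn_gt0 // divr_gt0.
have /cvgrPdist_lt /(_ _ d2) [N _ HN] := coord2P x.
set L := limn _ in HN; exists N.
(* The part of the series beyond N is at most what is missing to L at N. *)
have Le m : series (fun k => sqn (x k)) m <= L.
  by apply: series_le_limn (coord2P x) => k; exact: sqn_ge0.
have tail m : series (fun k => sqn ((x - trunc2 N x) k)) m <= (d / 2) ^+ 2.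
  apply: (@le_trans _ _ (L - series (fun k => sqn (x k)) N)); last first.
    have := HN N (leqnn N); rewrite /= ger0_norm; first exact: ltW.
    by rewrite subr_ge0; exact: Le.
  have z k : (k < N)%N -> sqn ((x - trunc2 N x) k) = 0.
    by move=> kN; rewrite coordB trunc2E kN subrr /sqn /= expr0n addr0.
  have [mN|Nm] := leqP m N.
    rewrite /series /= big_nat big1 => [|k /andP[_ km]].
      by rewrite subr_ge0; exact: Le.
    by rewrite z // (leq_trans km).
  rewrite lerBrDr; apply: le_trans (Le m); rewrite /series /=.
  rewrite !(big_cat_nat (n := N) (leq0n _) (ltnW Nm)) /=.
  rewrite big_nat big1 => [|k /andP[_ kN]]; last exact: z.
  rewrite add0r [leLHS]addrC lerD2l big_nat [leRHS]big_nat; apply: ler_sum => k.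
  by move=> /andP[Nk _]; rewrite coordB trunc2E ltnNge Nk subr0.
apply: (@le_lt_trans _ _ (d / 2)%:C%C); last first.
  by rewrite ltcR ltr_pdivrMr // mulr_natr mulr2n ltrDl.
rewrite -(ler_pXn2r (n := 2)) ?nnegrE ?ler0c ?divr_ge0 ?(ltW d0) //.
rewrite -hip_norm -rmorphXn; exact: (ell2_ip_le tail).
Qed.

End Ell2Complete.

(** * Partial isometries from partial bijections *)

Section Shifts.
Variable R : realType.
Local Notation H := (ell2 R).
Implicit Types x y z : H.

Record partial_bij := PartialBij {
  pb_rel :> nat -> nat -> Prop ;
  pb_fun : forall i j k, pb_rel i j -> pb_rel i k -> j = k ;
  pb_inj : forall i j k, pb_rel i k -> pb_rel j k -> i = j
}.

Definition pb_image (r : partial_bij) (i : nat) : option nat :=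
  if pselect (exists j, r i j) is left h then Some (projT1 (cid h)) else None.

Lemma pb_imageP (r : partial_bij) i j : pb_image r i = Some j <-> r i j.
Proof.
rewrite /pb_image; case: pselect => [h|h]; last by split=> // rij; case: h; exists j.
case: (cid h) => k rik /=; split=> [[<-] //|rij].
by rewrite (pb_fun rij rik).
Qed.

Definition pb_inv (r : partial_bij) : partial_bij :=
  @PartialBij (fun i j => r j i) (fun i j k rij rik => pb_inj rij rik)
    (fun i j k rik rjk => pb_fun rik rjk).

(** Composition with a partial function, extended by zero: the adjoint of the
    operator that moves the basis vectors along the partial bijection. *)
Definition pull (r : partial_bij) (f : nat -> R[i]) (i : nat) : R[i] :=
  oapp f 0 (pb_image r i).

Lemma pull_rel (r : partial_bij) f i j : r i j -> pull r f i = f j.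
Proof. by rewrite /pull => /pb_imageP ->. Qed.

Lemma pull_out (r : partial_bij) f i : (forall j, ~ r i j) -> pull r f i = 0.
Proof.
move=> h; rewrite /pull; case E: (pb_image r i) => [j|//].
by case: (h j); apply/pb_imageP.
Qed.

Lemma sum_uniq_le (a : nat -> R) (s : seq nat) (m : nat) : (forall k, 0 <= a k) ->
  uniq s -> {in s, forall k, (k < m)%N} ->
  \sum_(k <- s) a k <= \sum_(0 <= k < m) a k.
Proof.
move=> a0 us sm; rewrite [leRHS](bigID (mem s)) /= -[leLHS]addr0; apply: lerD.
  rewrite -[leRHS]big_filter [leRHS](perm_big s) // uniq_perm ?filter_uniq ?iota_uniq // => k.
  rewrite mem_filter mem_index_iota /=.
  by apply/andP/idP => [[]//|ks]; split => //; exact: sm.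
by apply: sumr_ge0 => k _.
Qed.

(** A partial bijection repeats no coordinate, so every partial sum of the
    pulled-back sequence is a sum over distinct coordinates of the original. *)
Lemma pull_series_le (r : partial_bij) x n :
  series (fun k => sqn (pull r x k)) n <= limn (series (fun k => sqn (x k))).
Proof.
have -> : series (fun k => sqn (pull r x k)) n =
    \sum_(j <- pmap (pb_image r) (index_iota 0 n)) sqn (x j).
  rewrite big_pmap /series /=; apply: eq_bigr => i _; rewrite /pull.
  by case: pb_image => //=; rewrite /sqn /= expr0n addr0.
set s := pmap _ _.
have us : uniq s.
  apply: (pmap_uniq (g := fun j => odflt 0%N (pb_image (pb_inv r) j))); last first.
    exact: iota_uniq.
  move=> i /=; case E: (pb_image r i) => [j|//] /=.
  have -> // : pb_image (pb_inv r) j = Some i.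
  by apply/pb_imageP; move/pb_imageP: E.
have sm : {in s, forall k, (k < (\max_(k <- s) k).+1)%N}.
  move=> k ks; rewrite ltnS.
  exact: (@leq_bigmax_seq _ _ xpredT (fun k => k) k ks isT).
apply: le_trans (sum_uniq_le (a := fun k => sqn (x k)) _ us sm) _.
  by move=> k; exact: sqn_ge0.
by apply: series_le_limn (coord2P x) => k; exact: sqn_ge0.
Qed.

Fact pull_summable (r : partial_bij) x : square_summable (pull r x).
Proof. by apply/square_summableP; eexists => n; exact: pull_series_le. Qed.

Definition pull2 (r : partial_bij) x : H := Ell2 (@pull_summable r x).

Lemma pull2_norm (r : partial_bij) x : `|pull2 r x| <= `|x|.
Proof.
rewrite -(ler_pXn2r (n := 2)) ?nnegrE // -!ell2_ip_norm [leRHS]ell2_ip_sqn.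
by apply: ell2_ip_le => n; exact: pull_series_le.
Qed.

Lemma pull2E (r : partial_bij) x i : pull2 r x i = pull r x i. Proof. by []. Qed.

Lemma pull2_lin (r : partial_bij) k x y :
  pull2 r (k *: x + y) = k *: pull2 r x + pull2 r y.
Proof.
apply: ell2_ext => i; rewrite coordD coordZ !pull2E /pull.
by case: pb_image => [j|] /=; rewrite ?coordD ?coordZ // mulr0 addr0.
Qed.

Lemma pull2_basis (r : partial_bij) i k : r i k -> pull2 r (basis2 R k) = basis2 R i.
Proof.
move=> rik; apply: ell2_ext => m; rewrite pull2E basis2E; have [->|mi] := eqVneq m i.
  by rewrite (@pull_rel r _ i k rik) basis2E eqxx.
rewrite /pull; case E: (pb_image r m) => [j|//]; move/pb_imageP: E => rmj.
rewrite /= basis2E; case: eqVneq => // jk; move: mi; rewrite jk in rmj.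
by rewrite (pb_inj rmj rik) eqxx.
Qed.

(** Both sides are bounded and additive in x, so it is enough to compare them
    on the basis vectors, whose span is dense. *)
Lemma pull2_adj (r : partial_bij) x y :
  hip (pull2 r x) y = hip x (pull2 (pb_inv r) y).
Proof.
pose D z := hip (pull2 r z) y - hip z (pull2 (pb_inv r) y).
have Dlin k z w : D (k *: z + w) = k * D z + D w.
  by rewrite /D pull2_lin !hipPl mulrBr opprD addrACA.
have D0 : D 0 = 0.
  have := Dlin 1 0 0; rewrite scaler0 addr0 mul1r => h.
  by apply: (addrI (D 0)); rewrite -h addr0.
have Dbasis k : D (basis2 R k) = 0.
  rewrite /D basis2_hip pull2E; apply/eqP; rewrite subr_eq0; apply/eqP.
  have [[i rik]|no] := pselect (exists i, r i k).
    rewrite (@pull_rel (pb_inv r) y k i rik).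
    by rewrite (pull2_basis rik) basis2_hip.
  rewrite pull_out => [|j rjk]; last by case: no; exists j.
  rewrite conjC0; have -> : pull2 r (basis2 R k) = 0; last by rewrite hip0l.
  apply: ell2_ext => m; rewrite pull2E coord0 /pull.
  case E: (pb_image r m) => [j|//]; move/pb_imageP: E => rmj.
  by rewrite /= basis2E; case: eqVneq => // jk; case: no; exists m; rewrite -jk.
have Dtrunc n z : D (trunc2 n z) = 0.
  rewrite /trunc2; elim/big_rec: _ => [//|k w _ hw].
  by rewrite Dlin Dbasis hw mulr0 addr0.
apply/eqP; rewrite -subr_eq0; apply/eqP; rewrite -/(D x).
apply: (@norm_small_eq0 R R[i]^o (2 * `|y|)) => [|e]; first by rewrite mulr_ge0.
move=> /trunc2_dense - /(_ x) [n xn].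
have -> : D x = D (x - trunc2 n x).
  by rewrite -{1}(subrK (trunc2 n x) x) -[x - _]scale1r Dlin Dtrunc addr0 mul1r scale1r.
apply: le_trans (ler_normB _ _) _; rewrite -mulrA mulr_natl mulr2n.
set w := x - _; have we : `|w| * `|y| <= `|y| * e.
  by rewrite mulrC ler_wpM2l // ltW.
apply: lerD; apply: le_trans (cauchy_schwarz _ _) _; apply: le_trans we.
  by rewrite ler_wpM2r // pull2_norm.
by rewrite ler_wpM2l // pull2_norm.
Qed.

Fact pull2_bound (r : partial_bij) :
  exists M : R, 0 <= M /\ forall x, `|pull2 r x| <= M%:C%C * `|x|.
Proof. by exists 1; split=> // x; rewrite mul1r pull2_norm. Qed.

Definition shift (r : partial_bij) : bop H :=
  Bop (pull2_adj r) (pull2_bound r).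

Lemma shiftE (r : partial_bij) x i : shift r x i = pull r x i.
Proof. by []. Qed.

Lemma shift_star (r : partial_bij) : (shift r)^# = shift (pb_inv r).
Proof. exact: bop_ext. Qed.

Program Definition diag_bij (D : nat -> Prop) : partial_bij :=
  @PartialBij (fun i j => i = j /\ D i) _ _.
Next Obligation. by move=> D i j k [<- _] [<- _]. Qed.
Next Obligation. by move=> D i j k [-> _] [-> _]. Qed.

Definition diag_proj (D : nat -> Prop) : bop H := shift (diag_bij D).

Lemma diag_projE D x i : diag_proj D x i = if pselect (D i) then x i else 0.
Proof.
rewrite shiftE; case: pselect => [Di|nDi].
  by rewrite (@pull_rel (diag_bij D) x i i).
by rewrite pull_out // => j [].
Qed.

Lemma diag_proj_star D : (diag_proj D)^# = diag_proj D.
Proof.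
apply: bop_ext => x; apply: ell2_ext => i; rewrite diag_projE shift_star shiftE.
case: pselect => [Di|nDi]; first by rewrite (@pull_rel (pb_inv (diag_bij D)) x i i).
by rewrite pull_out // => j [-> Dj].
Qed.

Lemma diag_projM D E :
  diag_proj D ** diag_proj E = diag_proj (fun i => D i /\ E i).
Proof.
apply: bop_ext => x; apply: ell2_ext => i.
rewrite bopME !diag_projE.
by case: pselect => [Di|nDi]; case: pselect => Ei; case: pselect => // -[].
Qed.

Lemma diag_proj_eq D E : (forall i, D i <-> E i) -> diag_proj D = diag_proj E.
Proof.
move=> DE; apply: bop_ext => x; apply: ell2_ext => i; rewrite !diag_projE.
by case: pselect => Di; case: pselect => // Ei; case: notF; move: Di Ei; rewrite DE.
Qed.

Lemma diag_proj_is_projection D : is_projection (diag_proj D).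
Proof.
split; first exact: diag_proj_star.
by rewrite diag_projM; apply: diag_proj_eq => i; split=> [[]|].
Qed.

Lemma diag_projB D E : (forall i, E i -> D i) ->
  diag_proj D - diag_proj E = diag_proj (fun i => D i /\ ~ E i).
Proof.
move=> ED; apply: bop_ext => x; apply: ell2_ext => i.
rewrite bopBE coordB !diag_projE; case: pselect => [Di|nDi].
  by case: pselect => Ei; case: pselect => //; rewrite ?subrr ?subr0 // => -[].
case: pselect => [Ei|nEi]; first by case: nDi; exact: ED.
by case: pselect => [h|nh]; [case: nDi; case: h | exact: subrr].
Qed.

(** A shift is a partial isometry between coordinate subspaces: its initial and
    final projections are diagonal. *)
Lemma shift_domain r : (shift r)^# ** shift r = diag_proj (fun j => exists i, r i j).
Proof.
apply: bop_ext => x; apply: ell2_ext => j; rewrite diag_projE shift_star.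
rewrite bopME shiftE.
case: pselect => [[i rij]|no].
  by rewrite (@pull_rel (pb_inv r) _ j i rij) shiftE (@pull_rel r x i j rij).
by rewrite pull_out // => i rij; apply: no; exists i.
Qed.

Lemma shift_range r : shift r ** (shift r)^# = diag_proj (fun i => exists j, r i j).
Proof.
have {1}-> : shift r = (shift (pb_inv r))^#.
  by rewrite shift_star; apply: bop_ext => x; apply: ell2_ext.
by rewrite (shift_star r) shift_domain.
Qed.

End Shifts.

(** * Branching systems and Cuntz--Krieger families *)

(** Combinatorial data that turn the Cuntz--Krieger relations into statements
    about partial bijections: [lab] splits the index set into pieces indexed by
    vertices, and [child e] maps the piece of [src e] injectively into the piece
    of [rng e], so that the pieces of receiving vertices are partitioned by the
    images. *)
Record branching_system (G : digraph) (I : Type) (lab : I -> vertex G -> Prop)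
    (child : edge G -> I -> I -> Prop) : Prop := BranchingSystem {
  bs_lab : forall i v w, lab i v -> lab i w -> v = w ;
  bs_parent : forall e f i j k, child e i k -> child f j k -> e = f /\ i = j ;
  bs_child : forall e i j k, child e i j -> child e i k -> j = k ;
  bs_src : forall e i, (exists j, child e i j) <-> lab i (src e) ;
  bs_rng : forall e i j, child e i j -> lab j (rng e) ;
  bs_cover : forall i v, lab i v -> (exists e : edge G, rng e = v) ->
    exists e j, child e j i
}.

(** The Hilbert space is indexed by the natural numbers, so other countable
    index sets are transported along [pickle]. *)
Definition nat_lab (V : Type) (I : countType) (lab : I -> V -> Prop) (n : nat) (v : V) :=
  exists2 i, pickle i = n & lab i v.
Definition nat_child (E : Type) (I : countType) (child : E -> I -> I -> Prop)
    (e : E) (m n : nat) :=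
  exists i j, [/\ pickle i = m, pickle j = n & child e i j].

Lemma branching_system_nat (G : digraph) (I : countType)
    (lab : I -> vertex G -> Prop) (child : edge G -> I -> I -> Prop) :
  branching_system lab child -> branching_system (nat_lab lab) (nat_child child).
Proof.
have pI := pcan_inj (@pickleK I).
case=> lab1 par1 ch1 src1 rng1 cov1; split.
- by move=> _ v w [i <-] iv [j /pI ->]; exact: lab1.
- move=> e f _ _ _ [i [k [<- <- c1]]] [j [l [<- /pI e2 c2]]]; subst l.
  by have [ef ij] := par1 _ _ _ _ _ c1 c2; rewrite ef ij.
- move=> e _ _ _ [i [j [<- <- c1]]] [k [l [/pI e1 <- c2]]]; subst k.
  by rewrite (ch1 _ _ _ _ c1 c2).
- move=> e n; split=> [[m [i [j [<- _ c]]]]|[i <- /src1 [j c]]].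
    by exists i => //; apply/src1; exists j.
  by exists (pickle j), i, j.
- by move=> e m n [i [j [_ <- c]]]; exists j => //; exact: rng1 c.
- move=> _ v [i <- iv] /(cov1 _ _ iv) [e [j c]].
  by exists e, (pickle j), j, i.
Qed.

Section BranchingFamily.
Variables (R : realType) (G : digraph).
Variables (lab : nat -> vertex G -> Prop) (child : edge G -> nat -> nat -> Prop).
Hypothesis bs : branching_system lab child.
Variable z : R[i].
Hypothesis z1 : `|z| = 1.

Definition edge_bij (e : edge G) : partial_bij :=
  @PartialBij (fun j i => child e i j)
    (fun k i j c1 c2 => proj2 (bs_parent bs c1 c2))
    (fun i j k c1 c2 => bs_child bs c1 c2).

Definition bs_proj (v : vertex G) : bop (ell2 R) :=
  diag_proj R (fun i => lab i v).
Definition bs_edge (e : edge G) : bop (ell2 R) := z *: shift R (edge_bij e).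

Let zz : Num.conj z * z = 1.
Proof. by rewrite mulrC -normCK z1 expr1n. Qed.

Lemma bs_edge_source e : (bs_edge e)^# ** bs_edge e = bs_proj (src e).
Proof.
rewrite cstarZ cmulZl cmulZr scalerA zz scale1r shift_domain.
by apply: diag_proj_eq => i; exact: bs_src bs e i.
Qed.

Lemma bs_edge_range e : bs_edge e ** (bs_edge e)^# =
  diag_proj R (fun i => exists j, child e j i).
Proof. by rewrite cstarZ cmulZl cmulZr scalerA mulrC zz scale1r shift_range. Qed.

Lemma bop_sum (H : hilbertType R) J (s : seq J) (F : J -> bop H) x :
  bfun (\sum_(j <- s) F j) x = \sum_(j <- s) F j x.
Proof. by apply: (big_morph (fun T : bop H => T x)). Qed.

(** All the range and source projections are diagonal, which reduces the
    relations to the partition properties of the branching system. *)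
Lemma branching_family : graph_family bs_proj bs_edge.
Proof.
split.
- by move=> v; exact: diag_proj_is_projection.
- move=> v w vw; rewrite diag_projM; apply: bop_ext => x; apply: ell2_ext => i.
  rewrite diag_projE; case: pselect => // -[iv iw].
  by case: vw; exact: bs_lab bs i v w iv iw.
- move=> e; rewrite /is_partial_isometry -cmulA bs_edge_source.
  apply: bop_ext => x; apply: ell2_ext => i.
  rewrite bopME !bopZE !coordZ !shiftE; congr (_ * _).
  have [[j c]|no] := pselect (exists j, child e j i).
    rewrite !(@pull_rel _ (edge_bij e) _ i j c) diag_projE.
    by case: pselect => // -[]; apply/(bs_src bs); exists i.
  by rewrite !pull_out // => j c; apply: no; exists j.
- move=> e f ef; rewrite !bs_edge_range diag_projM.
  apply: bop_ext => x; apply: ell2_ext => i; rewrite diag_projE.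
  case: pselect => // -[[j c1] [k c2]].
  by case: ef; have [] := bs_parent bs c1 c2.
- exact: bs_edge_source.
- move=> v ne fin; rewrite fsbig_finite //=.
  apply: bop_ext => x; apply: ell2_ext => i; rewrite bop_sum coord_sum.
  rewrite (eq_bigr (fun e => if pselect (exists j, child e j i) then x i else 0)).
    rewrite diag_projE; case: pselect => [iv|niv].
      have [e [j c]] : exists e j, child e j i by apply: (bs_cover bs iv).
      have ev : rng e = v by apply: (bs_lab bs _ iv); exact: bs_rng bs e j i c.
      rewrite (bigD1_seq e) ?finmap.fset_uniq //=; last by rewrite in_fset_set ?inE.
      rewrite big1 ?addr0 => [|f fe]; case: pselect => [h|h] //.
        by case: h; exists j.
      have [k c'] := h; move: fe.
      by have [-> _] := bs_parent bs c c'; rewrite eqxx.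
    rewrite big_seq big1 // => e; rewrite in_fset_set // inE /= => ev.
    case: pselect => [h|h] //; have [j c] := h; case: niv.
    by rewrite -ev; exact: bs_rng bs e j i c.
  by move=> e _; rewrite bs_edge_range diag_projE.
- move=> e; rewrite /cle bs_edge_range diag_projB; last first.
    by move=> i [j c]; exact: bs_rng bs e j i c.
  set d := diag_proj _ _; exists d; have [-> ->] // := diag_proj_is_projection R
    (fun i => lab i (rng e) /\ ~ (exists j, child e j i)).
Qed.

End BranchingFamily.

Lemma bs_proj_neq0 (R : realType) (G : digraph) (lab : nat -> vertex G -> Prop) i v :
  lab i v -> bs_proj R lab v <> 0.
Proof.
move=> iv h; have := congr1 (fun T : bop (ell2 R) => T (basis2 R i) i) h.
rewrite /= diag_projE; case: pselect => [li|//]; rewrite basis2E eqxx.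
by move/eqP; rewrite oner_eq0.
Qed.

(** * Vertex projections are nonzero *)

(** Every graph acts on vertices times natural numbers: each receiving vertex
    has countably infinitely many pairs (incoming edge, number), hence one
    countably infinite piece is the disjoint union of as many copies of itself. *)
Lemma free_branching_system (G : digraph) :
  exists child : edge G -> vertex G * nat -> vertex G * nat -> Prop,
    branching_system (fun i v => i.1 = v) child.
Proof.
pose In (v : vertex G) : set (edge G * nat) := [set x | rng x.1 = v].
have /choice [phi Hphi] : forall v, exists phi : edge G * nat -> nat,
    (exists e : edge G, rng e = v) -> set_bij (In v) [set: nat] phi.
  move=> v; have [[e ev]|no] := pselect (exists e : edge G, rng e = v); last first.
    by exists (fun=> 0%N) => /no.
  have inf : infinite_set (In v).
    move=> fin; apply: infinite_nat.
    by apply: sub_finite_set (finite_image snd fin) => n _; exists (e, n).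
  have /card_set_bijP [phi phiP] := eq_card_nat (countableP (In v)) inf.
  by exists phi.
exists (fun e i j => [/\ i.1 = src e, j.1 = rng e & phi (rng e) (e, i.2) = j.2]).
split=> /=.
- by move=> i v w <-.
- move=> e f [u m] [v n] [w k] /= [-> -> h1] [-> h2 h3].
  have [_ phi_inj _] : set_bij (In (rng e)) [set: nat] (phi (rng e)).
    by apply: Hphi; exists e.
  have [] : (e, m) = (f, n).
    by apply: phi_inj; rewrite ?inE /In //= h1 h2 h3.
  by move=> -> ->.
- by move=> e [u m] [v n] [w k] /= [_ -> ->] [_ -> ->].
- move=> e [u m] /=; split=> [[_ [] //]|->].
  by exists (rng e, phi (rng e) (e, m)).
- by move=> e i j [].
- move=> [v n] w /= <- rv; have [_ _ phi_surj] := Hphi v rv.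
  have [[e m] /= ev phin] := phi_surj n I; exists e, (src e, m).
  by split=> //=; rewrite ev.
Qed.

(** The homomorphism to the operators of the free branching system maps the
    projection of v to the projection onto a nonzero subspace. *)
Lemma graph_proj_neq0 (R : realType) (G : digraph) (A : cstarAlgType R)
    (p : vertex G -> A) (s : edge G -> A) :
  is_graph_cstar p s -> forall v, p v <> 0.
Proof.
move=> hA v pv.
have [child bs] := free_branching_system G.
have bsn := branching_system_nat bs.
have [f [hf fp _]] := gc_universal hA (branching_family bsn (normr1 R[i])).
have := fp v; rewrite pv star_hom0 // => /esym.
by apply: (@bs_proj_neq0 _ _ _ (pickle (v, 0%N))); exists (v, 0%N).
Qed.

(** * Traces in finite-dimensional representations *)

(** For this relation the cycles of the graph are cyclic sequences, which can be
    rotated and in which every edge has a successor. *)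
Definition follows (G : digraph) : rel (edge G) := fun e f => src f == rng e.

Lemma is_cycleP (G : digraph) (mu : seq (edge G)) :
  is_cycle mu <-> mu <> [::] /\ cycle (@follows G) mu.
Proof.
case: mu => [|e mu] /=; first by split=> // -[].
rewrite rcons_path; split=> [[pm cl]|[_ /andP[pm /eqP cl]]]; last by [].
by split=> //; apply/andP; split => //; rewrite /follows cl.
Qed.

Lemma cycle_vertex_rng (G : digraph) (mu : seq (edge G)) v : is_cycle mu ->
  v \in path_vertices mu -> exists2 x, x \in mu & rng x = v.
Proof.
move=> /is_cycleP[_ cmu]; rewrite mem_cat => /orP[]/mapP[x xmu ->]; last by exists x.
exists (prev mu x); first by rewrite mem_prev.
by have /eqP := prev_cycle cmu xmu.
Qed.

Section AdjointMatrices.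
Variables (R : realType) (n : nat).
Implicit Types M P : 'M[R[i]]_n.

Definition adjm M : 'M[R[i]]_n := map_mx Num.conj M^T.

Lemma tr_adjm_mul M : \tr (adjm M *m M) = \sum_j \sum_i `|M i j| ^+ 2.
Proof.
rewrite /mxtrace; apply: eq_bigr => j _; rewrite mxE; apply: eq_bigr => i _.
by rewrite !mxE mulrC -normCK.
Qed.

Lemma tr_adjm_ge0 M : 0 <= \tr (adjm M *m M).
Proof. by rewrite tr_adjm_mul; do 2![apply: sumr_ge0 => ? _]; rewrite exprn_ge0. Qed.

Lemma tr_adjm_eq0 M : \tr (adjm M *m M) = 0 -> M = 0.
Proof.
rewrite tr_adjm_mul => h; apply/matrixP => i j; rewrite mxE.
have hj : \sum_i `|M i j| ^+ 2 = 0.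
  by apply: (psumr_eq0P _ h) => // k _; apply: sumr_ge0 => ? _; rewrite exprn_ge0.
have : `|M i j| ^+ 2 = 0.
  by apply: (psumr_eq0P _ hj) => // k _; rewrite exprn_ge0.
by move/eqP; rewrite sqrf_eq0 normr_eq0 => /eqP.
Qed.

Lemma adjmM M P : adjm (M *m P) = adjm P *m adjm M.
Proof. by rewrite /adjm trmx_mul map_mxM. Qed.

Lemma adjmB M P : adjm (M - P) = adjm M - adjm P.
Proof. by rewrite /adjm linearB /= map_mxB. Qed.

Lemma adjm_sum J (r : seq J) (F : J -> 'M[R[i]]_n) :
  adjm (\sum_(j <- r) F j) = \sum_(j <- r) adjm (F j).
Proof.
apply: (big_morph adjm) => [M P|]; first by rewrite /adjm linearD /= map_mxD.
by rewrite /adjm trmx0 map_mx0.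
Qed.

Lemma adjm1 : adjm 1%:M = 1%:M.
Proof. by rewrite /adjm trmx1 map_mx1. Qed.

Lemma tr_proj_ge0 P : adjm P = P -> P *m P = P -> 0 <= \tr P.
Proof. by move=> Ps PP; rewrite -PP -{1}Ps tr_adjm_ge0. Qed.

Lemma tr_proj_eq0 P : adjm P = P -> P *m P = P -> \tr P = 0 -> P = 0.
Proof. by move=> Ps PP; rewrite -{1}PP -{1}Ps => /tr_adjm_eq0. Qed.

Lemma tr_proj_le P : adjm P = P -> P *m P = P -> \tr P <= n%:R.
Proof.
move=> Ps PP; rewrite -(mxtrace1 R[i] n) -subr_ge0 -linearB /=.
apply: tr_proj_ge0; first by rewrite adjmB adjm1 Ps.
by rewrite mulmxBl !mulmxBr !mul1mx mulmx1 PP subrr subr0.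
Qed.

End AdjointMatrices.

Section FiniteDimensionalTraces.
Variables (R : realType) (G : digraph) (A : cstarAlgType R).
Variables (p : vertex G -> A) (s : edge G -> A).
Hypothesis gf : graph_family p s.
Variables (n : nat) (f : A -> 'M[R[i]]_n).
Hypothesis hf : fin_dim_rep f.

Let fM a b : f (a ** b) = f a *m f b. Proof. by case: hf. Qed.
Let fS a : f a^# = adjm (f a). Proof. by case: hf. Qed.
Let fD a b : f (a + b) = f a + f b.
Proof. by case: hf => lf _ _; have := lf 1 a b; rewrite !scale1r. Qed.
Let f0 : f 0 = 0.
Proof. by apply: (addrI (f 0)); rewrite -fD !addr0. Qed.
Let fB a b : f (a - b) = f a - f b.
Proof.
apply/eqP; rewrite eq_sym subr_eq; apply/eqP.
by rewrite -fD subrK.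
Qed.

Local Notation t v := (\tr (f (p v))).

Lemma rep_proj v : adjm (f (p v)) = f (p v) /\ f (p v) *m f (p v) = f (p v).
Proof. by have [ps pp] := gf_proj gf v; rewrite -fS -fM ps pp. Qed.

Lemma tr_range e : \tr (f (s e ** (s e)^#)) = t (src e).
Proof. by rewrite fM mxtrace_mulC -fM (gf_source gf). Qed.

Lemma rep_range e (P := f (s e ** (s e)^#)) : adjm P = P /\ P *m P = P.
Proof.
rewrite /P -fS -fM cstarM cstarK; split=> //.
by rewrite cmulA (gf_pisom gf e).
Qed.

Lemma tr_src_le_rng e : t (src e) <= t (rng e).
Proof.
have [c hc] := gf_range gf e.
by rewrite -tr_range -subr_ge0 -linearB /= -fB hc fM fS tr_adjm_ge0.
Qed.

Lemma tr_src_eq_rng e : t (rng e) <= t (src e) -> f (p (rng e)) = f (s e ** (s e)^#).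
Proof.
move=> le; have [c hc] := gf_range gf e.
have : \tr (f (p (rng e)) - f (s e ** (s e)^#)) = 0.
  by apply/eqP; rewrite linearB /= subr_eq0 tr_range eq_le le tr_src_le_rng.
rewrite -fB hc fM fS => /tr_adjm_eq0 fc.
by apply/eqP; rewrite -subr_eq0 -fB hc fM fc mulmx0.
Qed.

(** Along a path the traces of the vertex projections cannot decrease; on a cycle
    they must therefore be constant. *)
Lemma tr_path_mono e mu x : path (@follows G) e mu -> x \in e :: mu ->
  t (src e) <= t (src x) /\ t (rng x) <= t (rng (last e mu)).
Proof.
elim: mu e x => [|g mu IH] e x /=; first by move=> _; rewrite inE => /eqP ->.
case/andP=> /eqP eg pg; rewrite inE => /orP[/eqP ->|xg].
  split=> //; apply: (le_trans _ (proj2 (IH _ _ pg (mem_head _ _)))).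
  by rewrite -eg tr_src_le_rng.
have [h1 h2] := IH _ _ pg xg; split=> //; apply: (le_trans _ h1).
by rewrite eg tr_src_le_rng.
Qed.

Lemma rep_cycle_edge mu x : is_cycle mu -> x \in mu ->
  f (p (rng x)) = f (s x ** (s x)^#).
Proof.
case: mu => [//|e mu] [pmu cl] xmu; apply: tr_src_eq_rng.
by have [h1 h2] := tr_path_mono pmu xmu; rewrite -cl in h2; exact: le_trans h2 h1.
Qed.

Lemma rep_source_eq0 e : f (s e ** (s e)^#) = 0 -> f (p (src e)) = 0.
Proof.
move=> h; rewrite -(gf_source gf) fM.
have -> : f (s e) = 0 by rewrite -(gf_pisom gf e) fM h mul0mx.
by rewrite mulmx0.
Qed.

(** In finite dimension the trace forces the edges of a cycle to exhaust the
    projections of the vertices they enter, so nothing is left for an entry. *)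
Lemma rep_cycle_entry_eq0 mu e : is_cycle mu -> rng e \in path_vertices mu ->
  e \notin mu -> f (p (src e)) = 0.
Proof.
move=> cmu /(cycle_vertex_rng cmu) [x xmu xe] emu.
apply: rep_source_eq0; set P := f _.
have [Ps PP] := rep_range e; rewrite -/P in Ps PP.
have ex : x <> e by move=> eqx; move: emu; rewrite -eqx xmu.
have zero : f (p (rng e)) *m P = 0.
  by rewrite -xe (rep_cycle_edge cmu xmu) -fM (gf_range_orth gf ex).
(* The projection P is orthogonal to p (rng e), so compressing the positive
   element p (rng e) - P to P gives - P. *)
have [c hc] := gf_range gf e.
apply: tr_proj_eq0 => //; apply/eqP; rewrite eq_le tr_proj_ge0 // andbT -oppr_ge0.
have -> : - \tr P = \tr (adjm (f c *m P) *m (f c *m P)).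
  rewrite adjmM Ps -mulmxA (mulmxA (adjm _)) -fS -fM -hc fB -/P.
  by rewrite mulmxBl zero PP sub0r mulmxN PP linearN.
exact: tr_adjm_ge0.
Qed.

(** The ranges of the edges out of w are orthogonal projections with the trace of
    the projection of w, and n bounds the sum of their traces. *)
Lemma rep_infinite_emitter_eq0 w : infinite_set [set e | src e = w] -> f (p w) = 0.
Proof.
move=> inf; have [pS pp] := rep_proj w; apply: tr_proj_eq0 => //.
have t0 : 0 <= t w by apply: tr_proj_ge0.
have bound N : t w *+ N <= n%:R.
  have [B Bw NB] := infinite_set_fset N inf.
  pose Q := \sum_(e <- finmap.enum_fset B) f (s e ** (s e)^#).
  have Qs : adjm Q = Q.
    by rewrite adjm_sum; apply: eq_bigr => e _; have [] := rep_range e.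
  have QQ : Q *m Q = Q.
    rewrite {1}/Q mulmx_suml; apply: eq_big_seq => e eB.
    rewrite /Q mulmx_sumr (bigD1_seq e) ?finmap.fset_uniq //=.
    have [_ ->] := rep_range e; rewrite big1 ?addr0 // => g ge.
    by rewrite -fM (gf_range_orth gf) // => eg; rewrite eg eqxx in ge.
  apply: le_trans (tr_proj_le Qs QQ).
  have -> : \tr Q = t w *+ (size (finmap.enum_fset B)).
    rewrite /Q linear_sum /= big_seq (eq_bigr (fun=> t w)); last first.
      by move=> e /Bw <-; exact: tr_range.
    by rewrite -big_seq big_const_seq count_predT iter_addr_0.
  by rewrite ler_wpMn2l.
apply/eqP; apply/negPn/negP => tn0.
have tp : 0 < t w by rewrite lt_def tn0.
have tr : t w = (complex.Re (t w))%:C%C by rewrite RRe_real // gtr0_real.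
move: tp bound; rewrite tr; set d := complex.Re _; rewrite (ltcR 0) => d0 bound.
have := bound (Num.bound (n%:R / d)).
rewrite -rmorphMn -(rmorph_nat (real_complex R)) lecR leNgt => /negP; apply.
rewrite -[ltRHS]mulr_natr [ltRHS]mulrC -ltr_pdivrMr //.
by apply: archi_boundP; rewrite divr_ge0 // ltW.
Qed.

End FiniteDimensionalTraces.

Lemma rfd_graph_conditions (R : realType) (G : digraph) (A : cstarAlgType R)
    (p : vertex G -> A) (s : edge G -> A) :
  finite_set [set: vertex G] -> is_graph_cstar p s -> residually_finite_dim A ->
  finite_digraph G /\ no_cycle_has_entry G.
Proof.
move=> finV hA [I [n [f [frep fsep]]]]; have gf := gc_family hA.
have sep a : (forall j, f j a = 0) -> a = 0.
  by move=> h; apply: contrapT => /fsep [j]; rewrite h.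
split.
  split=> //; apply: contrapT => infE.
  have [w infw] : exists w, infinite_set [set e : edge G | src e = w].
    apply: contrapT => /forallNP fin; apply: infE.
    apply: (@sub_finite_set _ _ (\bigcup_(w in [set: vertex G]) [set e | src e = w])).
      by move=> e _; exists (src e).
    by apply: bigcup_finite => // w _; apply: contrapT; exact: fin.
  apply: (graph_proj_neq0 hA (v := w)); apply: sep => j.
  exact: (rep_infinite_emitter_eq0 gf (frep j) infw).
move=> mu cmu e emu; apply/negPn/negP => enmu.
apply: (graph_proj_neq0 hA (v := src e)); apply: sep => j.
exact: (rep_cycle_entry_eq0 gf (frep j) cmu emu enmu).
Qed.

(** * The norm of a polynomial in a unitary *)

(** Taking roots removes a linear factor. By Bernoulli's inequality, applied
    twice, (a / b)^(2 m) would grow at least like m^2 if a / b exceeded 1. *)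
Lemma subexponential_le (R : realType) (a b : R) (c : nat) : 0 <= a -> 0 <= b ->
  (forall j, a ^+ (2 ^ j) <= (c * 2 ^ j).+1%:R * b ^+ (2 ^ j)) -> a <= b.
Proof.
move=> a0 b0 H; rewrite leNgt; apply/negP => ba.
have [b00|bn0] := eqVneq b 0.
  by have := H 0%N; rewrite b00 expn0 !expr1 mulr0 leNgt -{1}b00 ba.
have bp : 0 < b by rewrite lt_def bn0.
pose h := a / b - 1; have hp : 0 < h by rewrite subr_gt0 ltr_pdivlMr // mul1r.
have bern m : 1 + m%:R * h <= (1 + h) ^+ m.
  elim: m => [|m IH]; first by rewrite mul0r addr0 expr0.
  rewrite exprS; apply: (@le_trans _ _ ((1 + h) * (1 + m%:R * h))).
    have m0 : 0 <= m%:R :> R by rewrite ler0n.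
    have mh : 0 <= m%:R * (h * h) by rewrite !mulr_ge0 // ltW.
    by rewrite -natr1; nra.
  by rewrite ler_wpM2l // addr_ge0 // ltW.
have key j : (2 ^ j)%:R * (h * h) <= 2 * c%:R.
  have := H j.+1; rewrite -ler_pdivrMr ?exprn_gt0 // -expr_div_n.
  have -> : a / b = 1 + h by rewrite /h addrC subrK.
  set m := (2 ^ j)%N; have -> : (2 ^ j.+1 = m * 2)%N by rewrite expnS mulnC.
  rewrite exprM => h1.
  have m0 : 0 < m%:R :> R by rewrite ltr0n expn_gt0.
  have h2 : (1 + m%:R * h) ^+ 2 <= ((1 + h) ^+ m) ^+ 2.
    rewrite ler_pXn2r ?nnegrE ?bern //.
      by rewrite addr_ge0 // mulr_ge0 ?(ltW m0) ?(ltW hp).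
    by rewrite exprn_ge0 // addr_ge0 ?(ltW hp).
  have {h1 h2} := le_trans h2 h1.
  rewrite -natr1 !natrM => h3.
  have {h3} : m%:R * (m%:R * (h * h)) <= m%:R * (2 * c%:R).
    have mh : 0 <= m%:R * h by rewrite mulr_ge0 // ltW.
    by move: h3; rewrite expr2; nra.
  by rewrite ler_pM2l.
pose N := Num.bound (2 * c%:R / (h * h)).
have hh : 0 < h * h by rewrite mulr_gt0.
have : 2 * c%:R / (h * h) < N%:R.
  by apply: archi_boundP; rewrite divr_ge0 ?mulr_ge0 // ltW.
rewrite ltr_pdivrMr // ltNge => /negP; apply; apply: le_trans (key N).
by rewrite ler_wpM2r ?ler_nat ?(ltW hh) // ltnW // ltn_expl.
Qed.

Section PolynomialBounds.
Variable R : realType.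
Implicit Types p : {poly R[i]}.

Lemma complex_prim_root_exists n : (0 < n)%N ->
  exists w : R[i], n.-primitive_root w.
Proof.
pose p : {poly R[i]} := 'X^n - 1; have [r Dp] := closed_field_poly_normal p.
move=> n_gt0; rewrite (monicP _) ?monicXnsubC // scale1r in Dp.
have rn1 : all n.-unity_root r.
  by apply/allP=> z; rewrite -root_prod_XsubC -Dp.
have sz_r : (n < (size r).+1)%N.
  by rewrite -(size_prod_XsubC r id) -Dp size_XnsubC.
have [|z] := hasP (has_prim_root n_gt0 rn1 _ sz_r); last by exists z.
by rewrite -separable_prod_XsubC -Dp separable_Xn_sub_1 // pnatr_eq0 -lt0n.
Qed.

(** Cauchy's estimate, with the average over the circle replaced by the average
    over the n-th roots of unity for n the size of the polynomial. *)
Lemma coef_le_circle p (M : R[i]) k : 0 <= M ->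
  (forall z, `|z| = 1 -> `|p.[z]| <= M) -> `|p`_k| <= M.
Proof.
move=> M0 HM; have [kp|pk] := ltnP k (size p); last by rewrite nth_default ?normr0.
have n_gt0 : (0 < size p)%N by apply: leq_ltn_trans kp.
have [w wprim] := complex_prim_root_exists n_gt0.
set n := size p in kp n_gt0 wprim *.
have wn : w ^+ n = 1 by exact: prim_expr_order.
have w1 : `|w| = 1.
  apply/eqP; rewrite -(pexpr_eq1 n_gt0) ?normr_ge0 //.
  by rewrite -normrX wn normr1.
have w0 : w != 0 by rewrite -normr_eq0 w1 oner_eq0.
have filt (i : 'I_n) : \sum_(j < n) (w ^+ i / w ^+ k) ^+ j =
    if i == k :> nat then n%:R else 0.
  case: eqP => [->|ik].
    rewrite divff ?expf_neq0 // (eq_bigr (fun=> 1)) => [|j _]; last by rewrite expr1n.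
    by rewrite sumr_const card_ord.
  set t := _ / _; have t1 : t != 1.
    apply/eqP => ht; apply: ik.
    have : w ^+ i = w ^+ k by rewrite -[LHS](divfK (expf_neq0 k w0)) -/t ht mul1r.
    by move/eqP; rewrite (eq_prim_root_expr wprim) !modn_small // => /eqP.
  have := subrX1 t n; have -> : t ^+ n = 1.
    by rewrite expr_div_n -!exprM ![(_ * n)%N]mulnC !exprM wn !expr1n divr1.
  by move/esym/eqP; rewrite subrr mulf_eq0 subr_eq0 (negbTE t1) => /eqP.
have e : n%:R * p`_k = \sum_(j < n) p.[w ^+ j] * (w ^+ k) ^- j.
  rewrite (eq_bigr (fun j : 'I_n => \sum_(i < n) p`_i * (w ^+ i / w ^+ k) ^+ j)).
    rewrite exchange_big /= (bigD1 (Ordinal kp)) //= -mulr_sumr.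
    rewrite (filt (Ordinal kp)) eqxx big1 ?addr0 1?mulrC // => i ik.
    by rewrite -mulr_sumr filt -val_eqE /= in ik *; rewrite (negbTE ik) mulr0.
  move=> j _; rewrite horner_coef mulr_suml; apply: eq_bigr => i _.
  by rewrite -mulrA exprMn exprVn -!exprM [(j * i)%N]mulnC.
have np : 0 < n%:R :> R[i] by rewrite ltr0n.
rewrite -(ler_pM2l np) -{1}(ger0_norm (ltW np)) -normrM e.
apply: le_trans (ler_norm_sum _ _ _) _.
apply: (@le_trans _ _ (\sum_(j < n) M)).
  apply: ler_sum => j _; rewrite normrM normfV !normrX w1 !expr1n invr1 mulr1.
  by apply: HM; rewrite normrX w1 expr1n.
by rewrite sumr_const card_ord mulr_natl.
Qed.

End PolynomialBounds.

Section UnitaryCalculus.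
Variables (R : realType) (A : cstarAlgType R) (one u : A).
Hypothesis uu : u^# ** u = one.
Hypothesis uu' : u ** u^# = one.
Hypothesis one_u : one ** u = u.
Implicit Types (p q : {poly R[i]}) (x y : A).

Lemma one_star : one^# = one. Proof. by rewrite -uu cstarM cstarK. Qed.
Lemma u_one : u ** one = u. Proof. by rewrite -uu cmulA uu' one_u. Qed.
Lemma one_one : one ** one = one.
Proof. by rewrite -{2 3}uu' cmulA one_u. Qed.

Lemma norm_one_le1 : `|one| <= 1.
Proof. by apply: norm_projection_le1; split; [exact: one_star | exact: one_one]. Qed.

Lemma norm_u_le1 : `|u| <= 1.
Proof. by rewrite -(ler_pXn2r (n := 2)) ?nnegrE // expr1n -cnorm_star uu norm_one_le1. Qed.

Definition upow n := iter n (cmul u) one.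

Lemma upowS n : upow n.+1 = u ** upow n. Proof. by []. Qed.

Lemma one_upow n : one ** upow n = upow n.
Proof. by case: n => [|n]; rewrite ?one_one // upowS cmulA one_u. Qed.

Lemma norm_upow_le1 n : `|upow n| <= 1.
Proof.
elim: n => [|n IH]; first exact: norm_one_le1.
rewrite upowS; apply: le_trans (cnormM _ _) _.
by rewrite -[leRHS]mulr1 ler_pM // norm_u_le1.
Qed.

(** The value of p at u in the unital subalgebra of [one]; the constant term is a
    multiple of [one]. *)
Definition peval p : A := \sum_(i < size p) p`_i *: upow i.

Lemma peval_widen p N : (size p <= N)%N -> peval p = \sum_(i < N) p`_i *: upow i.
Proof.
move=> pN; rewrite /peval (big_ord_widen N (fun i => p`_i *: upow i) pN).
rewrite [RHS](bigID (fun i : 'I_N => (i < size p)%N)) /= [X in _ + X]big1 ?addr0 //.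
by move=> i; rewrite -leqNgt => pi; rewrite nth_default // scale0r.
Qed.

Lemma pevalD p q : peval (p + q) = peval p + peval q.
Proof.
rewrite (peval_widen (size_polyD p q)).
rewrite (peval_widen (leq_maxl (size p) (size q))).
rewrite (peval_widen (leq_maxr (size p) (size q))) -big_split /=.
by apply: eq_bigr => i _; rewrite coefD scalerDl.
Qed.

Lemma pevalZ k p : peval (k *: p) = k *: peval p.
Proof.
rewrite (peval_widen (N := size p)) ?size_scale_leq // /peval scaler_sumr.
by apply: eq_bigr => i _; rewrite coefZ scalerA.
Qed.

Lemma pevalMX p : peval (p * 'X) = u ** peval p.
Proof.
have sz : (size (p * 'X)%R <= (size p).+1)%N.
  by have [->|p0] := eqVneq p 0; rewrite ?mul0r ?size_poly0 // size_mulX.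
rewrite (peval_widen sz) big_ord_recl coefMX /= scale0r add0r cmul_sumr.
by apply: eq_bigr => i _; rewrite coefMX /= cmulZr.
Qed.

Lemma pevalXn n : peval 'X^n = upow n.
Proof.
rewrite (peval_widen (N := n.+1)) ?size_polyXn // big_ord_recr /= big1 => [|i _].
  by rewrite add0r coefXn eqxx scale1r.
by rewrite coefXn ltn_eqF ?scale0r.
Qed.

Lemma one_peval p : one ** peval p = peval p.
Proof. by rewrite cmul_sumr; apply: eq_bigr => i _; rewrite cmulZr one_upow. Qed.

Lemma peval0 : peval 0 = 0.
Proof. by rewrite /peval size_poly0 big_ord0. Qed.

Lemma pevalM p q : peval (p * q) = peval p ** peval q.
Proof.
elim/poly_ind: p => [|p c IH]; first by rewrite mul0r peval0 cmul0l.
rewrite mulrDl -mulrA ['X * q]mulrC mulrA mul_polyC !pevalD !pevalMX pevalZ IH.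
rewrite cmulDl cmulA; congr (_ + _).
by rewrite -[c%:P]alg_polyC pevalZ -(expr0 'X) pevalXn cmulZl one_peval.
Qed.

Lemma comm_peval x p : x ** u = u ** x -> x ** one = one ** x ->
  x ** peval p = peval p ** x.
Proof.
move=> xu x1; rewrite cmul_sumr cmul_suml; apply: eq_bigr => i _.
rewrite cmulZl cmulZr; congr (_ *: _); elim: {i}(i : nat) => [//|n IH].
by rewrite upowS cmulA xu -cmulA IH cmulA.
Qed.

Lemma peval_normal p : (peval p)^# ** peval p = peval p ** (peval p)^#.
Proof.
have us : u^# ** one = u^# by rewrite -one_star -cstarM one_u.
have su : one ** u^# = u^# by rewrite -[X in X ** _]one_star -cstarM u_one.
apply: comm_peval.
  apply: (can_inj (@cstarK _ _)); rewrite !cstarM cstarK.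
  by apply: comm_peval; rewrite ?uu ?uu' // us su.
apply: (can_inj (@cstarK _ _)); rewrite !cstarM cstarK one_star.
by apply: comm_peval; rewrite ?one_u ?u_one.
Qed.

Lemma norm_normal_sqr y : y^# ** y = y ** y^# -> `|y ** y| = `|y| ^+ 2.
Proof.
move=> ny; apply/eqP; rewrite -(eqrXn2 (n := 2)) ?exprn_ge0 // -cnorm_star.
have -> : (y ** y)^# ** (y ** y) = (y^# ** y)^# ** (y^# ** y).
  by rewrite !cstarM cstarK -!cmulA; congr (_ ** _); rewrite !cmulA ny.
by rewrite cnorm_star cnorm_star.
Qed.

Lemma norm_peval_le p (M : R[i]) : 0 <= M ->
  (forall z, `|z| = 1 -> `|p.[z]| <= M) -> `|peval p| <= (size p)%:R * M.
Proof.
move=> M0 HM; apply: le_trans (ler_norm_sum _ _ _) _.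
apply: (@le_trans _ _ (\sum_(i < size p) M)); last first.
  by rewrite sumr_const card_ord mulr_natl.
apply: ler_sum => i _; rewrite normrZ -[leRHS]mulr1.
by rewrite ler_pM ?norm_upow_le1 // coef_le_circle.
Qed.

(** Powers of p lose only a factor linear in the exponent in the crude estimate
    by coefficients, while the norm of a normal element is multiplicative along
    the powers 2^j; taking 2^j-th roots removes the factor. *)
Lemma norm_peval_circle p (M : R[i]) : 0 <= M ->
  (forall z, `|z| = 1 -> `|p.[z]| <= M) -> `|peval p| <= M.
Proof.
move=> M0 HM.
have pows j : `|peval (p ^+ (2 ^ j))| = `|peval p| ^+ (2 ^ j).
  elim: j => [|j IH]; first by rewrite expn0 !expr1.
  rewrite expnS mulnC !exprM expr2 pevalM norm_normal_sqr ?IH //.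
  exact: peval_normal.
have Mr : M = (complex.Re M)%:C%C by rewrite RRe_real // ger0_real.
have yr : `|peval p| = (complex.Re `|peval p|)%:C%C by rewrite RRe_real // ger0_real.
rewrite Mr yr lecR; apply: (subexponential_le (c := (size p).-1)).
- by rewrite -ler0c -yr.
- by rewrite -ler0c -Mr.
move=> j; rewrite -lecR rmorphM !rmorphXn rmorph_nat /= -Mr -yr -pows.
apply: (@le_trans _ _ ((size (p ^+ (2 ^ j)))%:R * M ^+ (2 ^ j))).
  apply: norm_peval_le => [|z z1]; first by rewrite exprn_ge0.
  by rewrite horner_exp normrX ler_pXn2r ?nnegrE ?expn_gt0 // HM.
by rewrite ler_wpM2r ?exprn_ge0 // ler_nat size_poly_exp_leq.
Qed.

End UnitaryCalculus.

(** * Terminal vertices of a graph without entries to cycles *)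

Section NoEntry.
Variable G : digraph.
Hypothesis finV : finite_set [set: vertex G].
Hypothesis finE : finite_set [set: edge G].
Hypothesis noentry : no_cycle_has_entry G.

Definition cyclic_vertex (v : vertex G) : Prop :=
  exists2 mu, is_cycle mu & v \in path_vertices mu.

Definition source_vertex (v : vertex G) : Prop := ~ exists e : edge G, rng e = v.

Definition terminal_vertex (v : vertex G) : Prop :=
  cyclic_vertex v \/ source_vertex v.

Lemma rng_in_path_vertices (mu : seq (edge G)) e : e \in mu -> rng e \in path_vertices mu.
Proof. by move=> emu; rewrite mem_cat map_f ?orbT. Qed.
Lemma src_in_path_vertices (mu : seq (edge G)) e : e \in mu -> src e \in path_vertices mu.
Proof. by move=> emu; rewrite mem_cat map_f. Qed.

(** The path behind its first edge e starts at the range of e, to which it returns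
    with f. *)
Lemma return_cycle (e f : edge G) (p1 p2 : seq (edge G)) :
  path (@follows G) e (p1 ++ f :: p2) -> rng e = rng f -> is_cycle (rcons p1 f).
Proof.
rewrite cat_path /= => /and3P[p1p fp _] ef.
apply/is_cycleP; split; first by case: (p1).
case: p1 p1p fp => [|x p1] /=; first by rewrite /follows ef => _ ->.
case/andP=> ex xp fp; rewrite !rcons_path xp fp /= last_rcons.
by move: ex; rewrite /follows ef.
Qed.

(** Cutting a cycle through two such edges at their common range leaves a shorter
    cycle through one of them; as that cycle has no entry, it contains the other
    edge too, so the descent would never end. *)
Lemma cycle_rng_inj mu (e f : edge G) : is_cycle mu -> e \in mu -> f \in mu ->
  rng e = rng f -> e = f.
Proof.
have [n] := ubnP (size mu); elim: n mu => // n IH mu mun cmu emu fmu ef.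
apply: contrapT => nef; have [_ cyc] := (is_cycleP _).1 cmu.
have [i q rq] := rot_to emu.
have cq : cycle (@follows G) (e :: q) by rewrite -rq rot_cycle.
have fq : f \in q.
  have : f \in e :: q by rewrite -rq mem_rot.
  by rewrite inE => /orP[/eqP fe|//]; case: nef.
have szq : (size q).+1 = size mu by rewrite -(size_rot i mu) rq.
move: cq szq; case/splitPr: q / fq rq => p1 p2 rq cq szq.
have cf : is_cycle (rcons p1 f).
  move: cq; rewrite /= rcons_cat /= => cq; exact: return_cycle cq ef.
have ep : e \in rcons p1 f.
  apply: (noentry cf); rewrite ef; apply: rng_in_path_vertices.
  by rewrite mem_rcons mem_head.
apply: nef; apply: IH cf ep _ ef; last by rewrite mem_rcons mem_head.
rewrite size_rcons; move: mun; rewrite -szq size_cat /= ltnS addnS.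
by apply: leq_trans; rewrite !ltnS leq_addr.
Qed.

Lemma cyclic_in_unique (e f : edge G) : cyclic_vertex (rng e) -> rng e = rng f -> e = f.
Proof.
move=> [mu cmu emu] ef; apply: (cycle_rng_inj cmu) => //; apply: (noentry cmu) => //.
by rewrite -ef.
Qed.

Lemma cyclic_src (e : edge G) : cyclic_vertex (rng e) -> cyclic_vertex (src e).
Proof.
move=> [mu cmu emu]; exists mu => //; apply: src_in_path_vertices.
exact: (noentry cmu).
Qed.

Lemma cyclic_in v : cyclic_vertex v -> exists e : edge G, rng e = v.
Proof. by move=> [mu cmu /(cycle_vertex_rng cmu) [x _ xv]]; exists x. Qed.

Lemma cyclic_out v : cyclic_vertex v ->
  exists2 e : edge G, src e = v & cyclic_vertex (rng e).
Proof.
move=> [mu cmu /(cycle_vertex_rng cmu) [x xmu <-]].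
have [_ cyc] := (is_cycleP _).1 cmu; exists (next mu x).
  by apply/eqP; exact: (next_cycle cyc xmu).
by exists mu => //; apply: rng_in_path_vertices; rewrite mem_next.
Qed.

(** A path that enters a vertex twice goes through a cycle at that vertex. *)
Lemma acyclic_path_uniq (b : seq (edge G)) : sorted (@follows G) b ->
  (forall x, x \in b -> ~ cyclic_vertex (rng x)) -> uniq (map (@rng G) b).
Proof.
elim: b => [//|e b IH] /= pb nc.
have sb : sorted (@follows G) b by apply: path_sorted pb.
rewrite IH ?andbT // => [|x xb]; last by apply: nc; rewrite inE xb orbT.
apply/negP => /mapP [f fb ef]; apply: (nc e); first exact: mem_head.
case/splitPr: b / fb pb {IH nc sb} => p1 p2.
move=> pb; exists (rcons p1 f); first exact: return_cycle pb ef.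
by rewrite ef rng_in_path_vertices // mem_rcons mem_head.
Qed.

Definition all_vertices : seq (vertex G) :=
  finmap.enum_fset (fset_set [set: vertex G]).

Lemma mem_all_vertices v : v \in all_vertices.
Proof. by rewrite in_fset_set ?inE. Qed.
Lemma all_vertices_uniq : uniq all_vertices.
Proof. exact: finmap.fset_uniq. Qed.

Lemma acyclic_path_size (b : seq (edge G)) : sorted (@follows G) b ->
  (forall x, x \in b -> ~ cyclic_vertex (rng x)) -> (size b <= size all_vertices)%N.
Proof.
move=> sb nc; rewrite -(size_map (@rng G)).
by apply: uniq_leq_size (acyclic_path_uniq sb nc) _ => v _; exact: mem_all_vertices.
Qed.

Lemma in_edge_exists v : exists e : option (edge G),
  if e is Some e then cyclic_vertex v /\ rng e = v else ~ cyclic_vertex v.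
Proof.
have [cv|ncv] := pselect (cyclic_vertex v); last by exists None.
by have [e ev] := cyclic_in cv; exists (Some e).
Qed.

Definition in_edge v : option (edge G) := projT1 (cid (in_edge_exists v)).
Lemma in_edgeP v : if in_edge v is Some e then cyclic_vertex v /\ rng e = v
  else ~ cyclic_vertex v.
Proof. exact: projT2 (cid (in_edge_exists v)). Qed.

Lemma in_edge_rng (e : edge G) : cyclic_vertex (rng e) -> in_edge (rng e) = Some e.
Proof.
move=> ce; have := in_edgeP (rng e); case: in_edge => [f [_ fe]|//].
by rewrite (cyclic_in_unique ce (esym fe)).
Qed.

(** One step backwards along the cycles, and the identity off them: a
    permutation of the vertices, since it is onto a finite set. *)
Definition back v : vertex G := if in_edge v is Some e then src e else v.

Lemma perm_back : perm_eq all_vertices (map back all_vertices).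
Proof.
have [] := @uniq_min_size _ all_vertices (map back all_vertices) all_vertices_uniq.
- move=> v _; apply/mapP; have [cv|ncv] := pselect (cyclic_vertex v).
    have [e ev ce] := cyclic_out cv; exists (rng e); first exact: mem_all_vertices.
    by rewrite /back in_edge_rng.
  exists v; first exact: mem_all_vertices.
  by rewrite /back; have := in_edgeP v; case: in_edge => // e [].
- by rewrite size_map.
move=> _ mem; apply: uniq_perm => //; first exact: all_vertices_uniq.
by rewrite (uniq_size_uniq all_vertices_uniq mem) size_map.
Qed.

Lemma back_inj : injective back.
Proof.
move=> v w bvw; apply/eqP; apply: contraT => vw.
have : uniq (map back all_vertices) by rewrite -(perm_uniq perm_back) all_vertices_uniq.
have pv := perm_to_rem (mem_all_vertices v).
have wr : w \in rem v all_vertices.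
  by rewrite (rem_filter _ all_vertices_uniq) mem_filter /= eq_sym vw mem_all_vertices.
by rewrite (perm_uniq (perm_map back pv)) /= bvw map_f.
Qed.

End NoEntry.

(** * The finite branching system of backward paths *)

Section BackwardPaths.
Variable G : digraph.
Hypothesis finV : finite_set [set: vertex G].
Hypothesis finE : finite_set [set: edge G].
Hypothesis noentry : no_cycle_has_entry G.

(** The backward paths from v, stopped at the first terminal vertex u. The edges
    are listed from the range, the opposite of the order used for cycles. *)
Fixpoint blab (a : seq (edge G)) (u v : vertex G) : Prop :=
  if a is e :: a' then [/\ ~ cyclic_vertex (rng e), blab a' u (src e) & v = rng e]
  else terminal_vertex u /\ v = u.

Definition path_lab (x : seq (edge G) * vertex G) (v : vertex G) : Prop :=
  blab x.1 x.2 v.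

Definition path_child (e : edge G) (x y : seq (edge G) * vertex G) : Prop :=
  path_lab x (src e) /\
  (cyclic_vertex (rng e) /\ y = ([::], rng e) \/
   ~ cyclic_vertex (rng e) /\ y = (e :: x.1, x.2)).

Lemma path_lab_cyclic x v : path_lab x v -> cyclic_vertex v -> x = ([::], v).
Proof. by case: x => [[|e a] u] /= [] => [_ ->|ne _ ->]. Qed.

(** Prolonging a backward path by an edge is a bijection unless the edge lies on
    a cycle; its range is then terminal, and the unique edge into it moves the
    empty path at its source to the empty path at its range. *)
Lemma path_branching_system : branching_system path_lab path_child.
Proof.
split.
- by case=> [[|e a] u] v w /= [] => [_ -> [_ ->]|_ _ -> [_ _ ->]].
- move=> e f x y z [xe [[ce ->]|[nce ->]]] [yf [[cf]|[ncf]]] // [].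
    move=> /(cyclic_in_unique noentry ce) ef; subst f; split=> //.
    have cs := cyclic_src noentry ce.
    by rewrite (path_lab_cyclic xe cs) (path_lab_cyclic yf cs).
  by case: x y {xe yf} => [a u] [b w] /= -> -> ->.
- by move=> e x y z [_ [[ce ->]|[nce ->]]] [_ [[ce' ->]|[nce' ->]]].
- move=> e x; split=> [[y []] //|xe].
  have [ce|nce] := pselect (cyclic_vertex (rng e)).
    by exists ([::], rng e); split=> //; left.
  by exists (e :: x.1, x.2); split=> //; right.
- by move=> e x y [xe [[ce ->]|[nce ->]]] /=; [split=> //; left | split].
- move=> [[|e a] u] v /= => [[[cu|su] ->] rec|[nce xa ->] _].
  + have [e eu] := rec; have ce : cyclic_vertex (rng e) by rewrite eu.
    exists e, ([::], src e); split; last by left; rewrite eu.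
    by split=> //; left; exact: cyclic_src.
  + by case: su.
  + by exists e, (a, u); split=> //; right.
Qed.

Lemma path_lab_size x v : path_lab x v -> (size x.1 <= size (all_vertices G))%N.
Proof.
case: x => a u /= lab_a.
suff [sa nc] : sorted (fun e f => src e == rng f) a /\
    (forall x, x \in a -> ~ cyclic_vertex (rng x)).
  rewrite -size_rev; apply: (acyclic_path_size finV) => [|x].
    by rewrite rev_sorted.
  by rewrite mem_rev; exact: nc.
elim: a v lab_a => [//|e a IH] v /= [nce la _]; have [sa nc] := IH _ la.
split; last by move=> x; rewrite inE => /orP[/eqP ->|/nc].
by case: a la sa {IH nc} => [//|f a] /= [_ _ ->] ->; rewrite eqxx.
Qed.

Lemma finite_bounded_seq n : finite_set [set a : seq (edge G) | (size a <= n)%N].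
Proof.
elim: n => [|n IH].
  by apply: (sub_finite_set _ (finite_set1 [::])) => a; rewrite /= leqn0 => /nilP.
apply: (sub_finite_set _ (_ : finite_set ([set [::]] `|`
   [set e :: a | e in [set: edge G] & a in [set a | (size a <= n)%N]]))).
  by case=> [|e a] /=; [left | right; exists e => //; exists a].
by rewrite finite_setU; split; [exact: finite_set1 | exact: finite_image2].
Qed.

Lemma path_lab_bounded : exists N, forall n v, nat_lab path_lab n v -> (n < N)%N.
Proof.
pose S := [set x : seq (edge G) * vertex G | exists v, path_lab x v].
have finS : finite_set S.
  apply: (sub_finite_set _ (finite_setX (finite_bounded_seq (size (all_vertices G))) finV)).
  by move=> x [v xv]; split=> //; exact: path_lab_size xv.
have [X SX] := finite_fsetP.1 (finite_image pickle finS).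
exists (\max_(n <- finmap.enum_fset X) n).+1 => n v [x xn xv]; rewrite ltnS.
have nX : n \in finmap.enum_fset X.
  have : [set pickle x | x in S] n by exists x => //; exists v.
  by rewrite SX.
exact: (@leq_bigmax_seq _ _ xpredT (fun k => k) n nX isT).
Qed.

End BackwardPaths.

(** * Monomials in the algebra of a finite graph *)

Section FiniteGraphAlgebra.
Variables (R : realType) (G : digraph) (A : cstarAlgType R).
Variables (p : vertex G -> A) (s : edge G -> A).
Hypothesis finV : finite_set [set: vertex G].
Hypothesis finE : finite_set [set: edge G].
Hypothesis gf : graph_family p s.
Hypothesis gen : forall S : set A, closed_star_subalgebra S ->
  (forall v, S (p v)) -> (forall e, S (s e)) -> S = setT.
Implicit Types (v w : vertex G) (e f : edge G) (a b c x : A).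

Lemma proj_star v : (p v)^# = p v. Proof. by have [] := gf_proj gf v. Qed.
Lemma proj_idem v : p v ** p v = p v. Proof. by have [] := gf_proj gf v. Qed.

Lemma edge_proj e : s e ** p (src e) = s e.
Proof. by rewrite -(gf_source gf) cmulA (gf_pisom gf e). Qed.

Lemma finite_in v : finite_set [set e : edge G | rng e = v].
Proof. exact: sub_finite_set finE. Qed.

Definition in_edges v : seq (edge G) :=
  finmap.enum_fset (fset_set [set e : edge G | rng e = v]).

Lemma mem_in_edges v e : (e \in in_edges v) = (rng e == v).
Proof.
rewrite in_fset_set; last exact: finite_in.
by apply/idP/eqP; rewrite inE.
Qed.

Lemma proj_sum v : (exists e : edge G, rng e = v) ->
  p v = \sum_(e <- in_edges v) (s e ** (s e)^#).
Proof.
by move=> [e ev]; rewrite (gf_sum gf _ (finite_in v)) ?fsbig_finite //;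
  [exact: finite_in | exists e].
Qed.

Lemma star_edge_orth e f : e <> f -> (s e)^# ** s f = 0.
Proof.
move=> ef.
have e1 : (s e)^# = (s e)^# ** (s e ** (s e)^#).
  by rewrite -{1}(gf_pisom gf e) !cstarM cstarK.
rewrite e1 -(gf_pisom gf f) -cmulA (cmulA (s e ** _)) (gf_range_orth gf ef).
by rewrite cmul0l cmul0r.
Qed.

(** For finite graphs the relation p (rng e) s e = s e follows from the sum
    formula; this avoids deriving it from the order between projections. *)
Lemma proj_edge e : p (rng e) ** s e = s e.
Proof.
rewrite proj_sum; last by exists e.
rewrite cmul_suml (bigD1_seq e) ?mem_in_edges ?finmap.fset_uniq //=.
rewrite (gf_pisom gf e) big1 ?addr0 // => f fe.
by rewrite -cmulA star_edge_orth ?cmul0r // => ef; rewrite ef eqxx in fe.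
Qed.

Lemma proj_edge_neq v e : v <> rng e -> p v ** s e = 0.
Proof. by move=> ve; rewrite -proj_edge cmulA (gf_proj_orth gf ve) cmul0l. Qed.

Definition unit_of_projs : A := \sum_(v <- all_vertices G) p v.

Local Notation one := unit_of_projs.

Lemma one_proj v : one ** p v = p v.
Proof.
rewrite cmul_suml (bigD1_seq v) ?mem_all_vertices ?all_vertices_uniq //=.
rewrite proj_idem big1 ?addr0 // => w wv; rewrite (gf_proj_orth gf) // => e.
by rewrite e eqxx in wv.
Qed.

Lemma one_starE : one^# = one.
Proof. by rewrite cstar_sum; apply: eq_bigr => v _; exact: proj_star. Qed.

Lemma one_edge e : one ** s e = s e.
Proof. by rewrite -proj_edge cmulA one_proj. Qed.

Lemma edge_one e : s e ** one = s e.
Proof. by rewrite -edge_proj -cmulA -one_starE -proj_star -cstarM one_proj. Qed.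

Lemma one_l a : one ** a = a.
Proof.
have full : [set a | one ** a = a /\ a ** one = a] = setT.
  apply: gen => [|v|e]; last 2 first.
  - by split; rewrite ?one_proj // -{1}proj_star -one_starE -cstarM one_proj proj_star.
  - by split; rewrite ?one_edge ?edge_one.
  split.
  - by rewrite /= cmul0l cmul0r.
  - move=> {}a b [a1 a2] [b1 b2]; rewrite /= cmulDr cmulDl a1 a2 b1 b2.
    by rewrite cmulA a1 -cmulA b2.
  - by move=> k {}a [a1 a2]; rewrite /= cmulZr cmulZl a1 a2.
  - by move=> {}a [a1 a2]; rewrite /= -{1 2}one_starE -!cstarM a1 a2.
  apply: closed_approx => {}a H.
  have small (g : A -> A) : (forall x y, g (x - y) = g x - g y) ->
      (forall x, `|g x| <= `|one| * `|x|) ->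
      (forall b, one ** b = b /\ b ** one = b -> g b = b) -> g a = a.
    move=> gB gn g1; apply/eqP; rewrite -subr_eq0; apply/eqP.
    apply: (@norm_small_eq0 _ _ (`|one| + 1)) => [|e]; first by rewrite addr_ge0.
    move=> /H [b /g1 gb ab]; have -> : g a - a = g (a - b) - (a - b).
      by rewrite gB gb opprB addrA subrK.
    apply: le_trans (ler_normB _ _) _; rewrite mulrDl mul1r.
    by apply: lerD; [apply: le_trans (gn _) _; rewrite ler_wpM2l // ltW | exact: ltW].
  split.
  - apply: (small (fun x => one ** x)) => [x y|x|b []] //; first exact: cmulBr.
    exact: cnormM.
  - apply: (small (fun x => x ** one)) => [x y|x|b []] //; first exact: cmulBl.
    by rewrite mulrC; exact: cnormM.
by have [] : [set a | one ** a = a /\ a ** one = a] a by rewrite full.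
Qed.

Lemma one_r a : a ** one = a.
Proof. by rewrite -[a]cstarK -one_starE -cstarM one_l. Qed.

(** Words that are not paths are allowed; they are 0. *)
Definition word (al : seq (edge G)) v : A := foldr (fun e x => s e ** x) (p v) al.

Lemma word_proj al v : word al v ** p v = word al v.
Proof. by elim: al => [|e al IH] /=; rewrite ?proj_idem // -cmulA IH. Qed.

Lemma proj_word w al v : p w ** word al v = word al v \/ p w ** word al v = 0.
Proof.
case: al => [|e al] /=.
  by have [->|/eqP wv] := eqVneq w v; [left; exact: proj_idem | right; exact: (gf_proj_orth gf)].
have [->|/eqP we] := eqVneq w (rng e); first by left; rewrite cmulA proj_edge.
by right; rewrite cmulA proj_edge_neq // cmul0l.
Qed.

Lemma word_rcons be f : word be (rng f) ** s f = word (rcons be f) (src f).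
Proof. by elim: be => [|e be IH] /=; rewrite ?proj_edge ?edge_proj // -cmulA IH. Qed.

Inductive monomial_span : A -> Prop :=
| MonoSpan0 : monomial_span 0
| MonoSpanD k al be v a : monomial_span a ->
    monomial_span (k *: (word al v ** (word be v)^#) + a).

Lemma span_add a b : monomial_span a -> monomial_span b -> monomial_span (a + b).
Proof.
by elim=> [|k al be v c _ IH] hb; rewrite ?add0r // -addrA; apply: MonoSpanD; exact: IH.
Qed.

Lemma span_scale k a : monomial_span a -> monomial_span (k *: a).
Proof.
elim=> [|l al be v c _ IH]; first by rewrite scaler0; exact: MonoSpan0.
by rewrite scalerDr scalerA; exact: MonoSpanD.
Qed.

Lemma span_mono al be v : monomial_span (word al v ** (word be v)^#).
Proof.
by rewrite -[_ ** _]scale1r -[_ *: _]addr0; apply: MonoSpanD; exact: MonoSpan0.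
Qed.

Lemma span_mul x : (forall al be v, monomial_span (x ** (word al v ** (word be v)^#))) ->
  forall a, monomial_span a -> monomial_span (x ** a).
Proof.
move=> H a; elim=> [|k al be v b _ IH]; first by rewrite cmul0r; exact: MonoSpan0.
by rewrite cmulDr cmulZr; apply: span_add => //; exact: span_scale.
Qed.

Lemma span_proj_mul w a : monomial_span a -> monomial_span (p w ** a).
Proof.
apply: span_mul => al be v; rewrite cmulA.
have [->|->] := proj_word w al v; first exact: span_mono.
by rewrite cmul0l; exact: MonoSpan0.
Qed.

Lemma span_edge_mul e a : monomial_span a -> monomial_span (s e ** a).
Proof.
by apply: span_mul => al be v; rewrite cmulA; exact: (span_mono (e :: al)).
Qed.

Lemma span_star_edge_mul e a : monomial_span a -> monomial_span ((s e)^# ** a).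
Proof.
apply: span_mul => -[|f al] be v; rewrite cmulA /=; last first.
  have [<-|/eqP ef] := eqVneq e f; last first.
    by rewrite cmulA star_edge_orth // !cmul0l; exact: MonoSpan0.
  rewrite cmulA (gf_source gf) -cmulA; apply: span_proj_mul; exact: span_mono.
rewrite -{1}(proj_star v) -!cstarM.
have [->|/eqP ve] := eqVneq v (rng e); last first.
  by rewrite proj_edge_neq // cmul0r cstar0; exact: MonoSpan0.
rewrite proj_edge word_rcons -word_proj cstarM proj_star.
exact: (span_mono [::]).
Qed.

(** The span of the monomials is a left module over the generators and their
    adjoints, so the elements that preserve its closure form a C*-subalgebra
    that contains the generators. *)
Lemma monomial_span_dense a (e : R[i]) : 0 < e -> exists2 b, monomial_span b & `|a - b| < e.
Proof.
pose N := closure monomial_span.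
suff Na : N a by move: e; apply/closureP.
have Nadd x y : N x -> N y -> N (x + y).
  move=> /closureP Nx /closureP Ny; apply/closureP => d d0.
  have d2 : 0 < d / 2 by rewrite divr_gt0.
  have [x' hx xx] := Nx _ d2; have [y' hy yy] := Ny _ d2.
  exists (x' + y'); first exact: span_add.
  rewrite opprD addrACA; apply: le_lt_trans (ler_normD _ _) _.
  by rewrite [ltRHS](splitr d) ltrD.
have Nclose x : (forall d : R[i], 0 < d -> exists2 y, N y & `|x - y| < d) -> N x.
  move=> H; apply/closureP => d d0; have d2 : 0 < d / 2 by rewrite divr_gt0.
  have [y /closureP Ny xy] := H _ d2; have [z hz yz] := Ny _ d2.
  exists z => //; rewrite -(subrK y x) -addrA.
  apply: le_lt_trans (ler_normD _ _) _.
  by rewrite [ltRHS](splitr d) ltrD.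
have small (K d : R[i]) : 0 <= K -> 0 < d ->
    exists2 d', 0 < d' & forall t, t < d' -> 0 <= t -> K * t < d.
  move=> K0 d0; have K1 : 0 < K + 1 by rewrite ltr_wpDl.
  exists (d / (K + 1)); first by rewrite divr_gt0.
  move=> t; rewrite ltr_pdivlMr // => td t0; apply: le_lt_trans td.
  by rewrite mulrC ler_wpM2l // lerDl.
have Nlip x K (g : A -> A) : 0 <= K -> (forall y z, `|g y - g z| <= K * `|y - z|) ->
    (forall y, monomial_span y -> N (g y)) -> N x -> N (g x).
  move=> K0 gl gs /closureP Nx; apply: Nclose => d d0.
  have [d' d'0 hd] := small _ _ K0 d0; have [y hy xy] := Nx _ d'0.
  by exists (g y); [exact: gs | apply: le_lt_trans (gl _ _) _; exact: hd].
have Nsub x : monomial_span x -> N x by move=> hx; apply: subset_closure.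
pose T : set A := [set x | forall y, N y -> N (x ** y)].
have TN x : (forall y, monomial_span y -> monomial_span (x ** y)) -> T x.
  move=> h y Ny; apply: (Nlip _ `|x| (fun y => x ** y)) => // [y' z|y' /h/Nsub //].
  by rewrite -cmulBr cnormM.
have : [set x | T x /\ T x^#] = setT.
  apply: gen => [|v|e']; last 2 first.
  - by rewrite /= proj_star; split; apply: TN => y; exact: span_proj_mul.
  - split; apply: TN => y; [exact: span_edge_mul | exact: span_star_edge_mul].
  have TD x y : T x -> T y -> T (x + y).
    by move=> hx hy z Nz; rewrite cmulDl; apply: Nadd; [exact: hx | exact: hy].
  have TM x y : T x -> T y -> T (x ** y).
    by move=> hx hy z Nz; rewrite -cmulA; apply: hx; exact: hy.
  have TZ (k : R[i]) x : T x -> T (k *: x).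
    move=> hx z Nz; rewrite cmulZl.
    apply: (Nlip _ `|k| (fun y => k *: y)) (hx _ Nz) => // [y y'|y /(span_scale k)/Nsub //].
    by rewrite -scalerBr normrZ.
  have Tcl x : (forall d : R[i], 0 < d -> exists2 y, T y & `|x - y| < d) -> T x.
    move=> H z Nz; apply: Nclose => d d0.
    have [d' d'0 hd] := small _ _ (normr_ge0 z) d0; have [y hy xy] := H _ d'0.
    exists (y ** z); first exact: hy.
    rewrite -cmulBl; apply: le_lt_trans (cnormM _ _) _.
    by rewrite mulrC; apply: hd.
  split.
  - split; rewrite ?cstar0 => y _; rewrite cmul0l; apply: Nsub; exact: MonoSpan0.
  - move=> x y [x1 x2] [y1 y2]; rewrite /= cstarD cstarM.
    by split; split; do [exact: TD | exact: TM].
  - by move=> k x [x1 x2]; rewrite /= cstarZ; split; exact: TZ.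
  - by move=> x [x1 x2]; rewrite /= cstarK.
  - apply: closed_approx => x H; split; apply: Tcl => d /H [y [y1 y2] xy].
      by exists y.
    by exists y^# => //; rewrite -cstarB cnorm_cstar.
move=> /(congr1 (fun S : set A => S a)) /= e1; have [Ta _] : T a /\ T a^# by rewrite e1.
rewrite -[a]one_r; apply: Ta; apply: Nsub; rewrite /one.
elim/big_rec: _ => [|v x _ hx]; first exact: MonoSpan0.
apply: span_add => //; rewrite -proj_idem -{2}proj_star.
exact: (span_mono [::] [::]).
Qed.

(** Multiplying by edges on the right walks backwards in the graph. It
    cannot visit non-terminal vertices forever, and some step always keeps the
    product nonzero, because p v is the sum of the ranges of the edges into v. *)
Lemma walk_to_terminal a : a <> 0 ->
  exists c w, [/\ terminal_vertex w, c ** p w = c & a ** c <> 0].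
Proof.
move=> a0; have [v av] : exists v, a ** p v <> 0.
  apply: contrapT => /forallNP H; apply: a0; rewrite -[a]one_r cmul_sumr big1 // => v _.
  exact: contrapT (H v).
suff walk k c u (b : seq (edge G)) : (size b + k = (size (all_vertices G)).+1)%N ->
    sorted (@follows G) b -> (forall x : edge G, x \in b -> ~ cyclic_vertex (rng x)) ->
    (if b is e :: _ then src e = u else True) -> c ** p u = c -> a ** c <> 0 ->
    exists c w, [/\ terminal_vertex w, c ** p w = c & a ** c <> 0].
  apply: (walk _ (p v) v [::] (add0n _)) => //; exact: proj_idem.
elim: k c u b => [|k IH] c u b.
  rewrite addn0 => szb sb nb; have := acyclic_path_size finV sb nb.
  by rewrite szb ltnn.
move=> szb sb nb bu cu ac; have [tu|ntu] := pselect (terminal_vertex u).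
  by exists c, u.
have ncu : ~ cyclic_vertex u by move=> cu'; apply: ntu; left.
have recu : exists e : edge G, rng e = u by apply: contrapT => nr; apply: ntu; right.
have [e eu ace] : exists2 e : edge G, rng e = u & a ** (c ** s e) <> 0.
  apply: contrapT => H; apply: ac; rewrite -cu proj_sum // !cmul_sumr big_seq big1 // => e.
  rewrite mem_in_edges => /eqP eu; rewrite !cmulA; apply: contrapT => ne; apply: H.
  exists e => // h; apply: ne; move: h; rewrite !cmulA => ->; exact: cmul0l.
apply: (IH (c ** s e) (src e) (e :: b)) => //.
- by rewrite /= addSnnS.
- by case: b sb bu {szb nb} => [//|f b] /= -> fu; rewrite /follows fu eu eqxx.
- by move=> x; rewrite inE => /orP[/eqP ->|/nb //]; rewrite eu.
- by rewrite -cmulA edge_proj.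
Qed.

End FiniteGraphAlgebra.

(** * Phase representations separate points *)

Section RationalCorners.
Variables (R : realType) (G : digraph) (A : cstarAlgType R).
Variables (p : vertex G -> A) (s : edge G -> A).
Hypothesis finV : finite_set [set: vertex G].
Hypothesis finE : finite_set [set: edge G].
Hypothesis noentry : no_cycle_has_entry G.
Hypothesis hA : is_graph_cstar p s.
Let gf := gc_family hA.
Implicit Types (v w : vertex G) (e : edge G) (a b : A).

Local Notation one := (unit_of_projs p).
Let onel a : one ** a = a := one_l finV finE gf (gc_generated hA) a.
Let oner a : a ** one = a := one_r finV finE gf (gc_generated hA) a.

(** The sum of the edges of the cycles and of the projections of the other
    vertices is a unitary, because [back] is a permutation. *)
Definition cycle_step v : A := if in_edge v is Some e then s e else p v.

Definition cycle_shift : A := \sum_(v <- all_vertices G) cycle_step v.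
Local Notation U := cycle_shift.

Lemma proj_step v : p v ** cycle_step v = cycle_step v.
Proof.
rewrite /cycle_step; have := in_edgeP v; case: in_edge => [e [_ <-]|_].
  exact: (proj_edge finE gf).
exact: (proj_idem gf).
Qed.

Lemma step_proj v : cycle_step v ** p (back v) = cycle_step v.
Proof.
rewrite /cycle_step /back; case: in_edge => [e|]; [exact: (edge_proj gf) | exact: (proj_idem gf)].
Qed.

Lemma step_source v : (cycle_step v)^# ** cycle_step v = p (back v).
Proof.
rewrite /cycle_step /back; case: in_edge => [e|]; first exact: gf_source gf e.
by rewrite (proj_star gf) (proj_idem gf).
Qed.

Lemma step_range v : cycle_step v ** (cycle_step v)^# = p v.
Proof.
rewrite /cycle_step; have := in_edgeP v; case: in_edge => [e [cv ev]|_]; last first.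
  by rewrite (proj_star gf) (proj_idem gf).
rewrite (proj_sum finE gf (ex_intro _ e ev)) (bigD1_seq e) ?(mem_in_edges finE) ?ev //=;
  last exact: finmap.fset_uniq.
rewrite big_seq_cond big1 ?addr0 // => f /andP[]; rewrite (mem_in_edges finE) => /eqP fv.
by rewrite (@cyclic_in_unique _ noentry e f) ?eqxx // ev.
Qed.

Lemma proj_shift w : p w ** U = cycle_step w.
Proof.
rewrite cmul_sumr (bigD1_seq w) ?mem_all_vertices ?all_vertices_uniq //=.
rewrite proj_step big1 ?addr0 // => v vw.
by rewrite -proj_step cmulA (gf_proj_orth gf) ?cmul0l // => e; rewrite e eqxx in vw.
Qed.

Lemma shift_proj_back w : U ** p (back w) = cycle_step w.
Proof.
rewrite cmul_suml (bigD1_seq w) ?mem_all_vertices ?all_vertices_uniq //=.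
rewrite step_proj big1 ?addr0 // => v vw.
rewrite -step_proj -cmulA (gf_proj_orth gf) ?cmul0r // => /(back_inj finV noentry) e.
by rewrite e eqxx in vw.
Qed.

Lemma shift_star_shift : U^# ** U = one.
Proof.
rewrite cstar_sum cmul_suml [RHS](perm_big _ (perm_back finV noentry)) [RHS]big_map.
apply: eq_bigr => v _; rewrite -[X in X^#]proj_step cstarM (proj_star gf) -cmulA.
by rewrite proj_shift step_source.
Qed.

Lemma shift_shift_star : U ** U^# = one.
Proof.
rewrite {1}/cycle_shift cmul_suml; apply: eq_bigr => v _.
rewrite -{1}step_proj -cmulA -(proj_star gf (back v)) -cstarM shift_proj_back.
exact: step_range.
Qed.

Local Notation upw := (upow one U).
Local Notation pev := (peval one U).

Let oneU : one ** U = U := onel U.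

Lemma upow_star_upow d : (upw d)^# ** upw d = one.
Proof.
elim: d => [|d IH]; first by rewrite (one_starE gf) onel.
by rewrite upowS cstarM -cmulA (cmulA U^#) shift_star_shift onel.
Qed.

Lemma upow_star_comm m d : upw m ** (upw d)^# = (upw d)^# ** upw m.
Proof.
have Uone : U^# ** one = U^# by exact: oner.
rewrite -(pevalXn _ _ m); symmetry; apply: comm_peval; last by rewrite onel oner.
apply: (can_inj (@cstarK _ _)); rewrite !cstarM cstarK -(pevalXn _ _ d).
by apply: comm_peval; rewrite ?onel ?oner // shift_star_shift shift_shift_star.
Qed.

Lemma upowD m d : upw (m + d) = upw m ** upw d.
Proof. by rewrite -!pevalXn exprD; apply: pevalM; rewrite ?shift_star_shift ?shift_shift_star. Qed.

Local Notation vertex_index w := (pickle ([::] : seq (edge G), w)).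
Local Notation vertex_vector w := (basis2 R (vertex_index w)).

Let bs := branching_system_nat (path_branching_system noentry).

(** The representation on the backward paths in which every edge carries the
    phase z; it sends the shift along the cycles to a weighted permutation. *)
Definition phase_rep (z : R[i]) (f : A -> bop (ell2 R)) : Prop :=
  [/\ star_hom f, forall v, f (p v) = bs_proj R (nat_lab (@path_lab G)) v &
      forall e, f (s e) = bs_edge bs z e].

Lemma phase_rep_exists z : `|z| = 1 -> exists f, phase_rep z f.
Proof.
move=> z1; have [f [h1 h2 h3]] := gc_universal hA (branching_family bs z1).
by exists f.
Qed.

Lemma phase_rep_proj z f w : phase_rep z f -> terminal_vertex w ->
  f (p w) (vertex_vector w) = vertex_vector w.
Proof.
move=> [_ fp _] tw; rewrite fp; apply: pull2_basis; split=> //.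
by exists ([::], w).
Qed.

Lemma phase_rep_edge z f e : phase_rep z f -> cyclic_vertex (rng e) ->
  bfun (f (s e))^# (vertex_vector (rng e)) = Num.conj z *: vertex_vector (src e).
Proof.
move=> [_ _ fs] ce; rewrite fs cstarZ shift_star bopZE; congr (_ *: _).
apply: pull2_basis; exists ([::], src e), ([::], rng e); split=> //.
by split; [split=> //; left; exact: cyclic_src | left].
Qed.

(** Backwards from a terminal vertex there is at most one path of each length, so
    a word is determined by its length once it is cut down to such a vertex. *)
Lemma word_corner w al v : terminal_vertex w ->
  p w ** word p s al v = 0 \/
  p w ** word p s al v = p w ** upw (size al) /\
  forall z f, phase_rep z f -> bfun (f (p w ** word p s al v))^# (vertex_vector w) =
    Num.conj z ^+ size al *: vertex_vector v.
Proof.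
elim: al w => [|e al IH] w tw.
  rewrite -[word _ _ _ _]/(p v); have [->|/eqP wv] := eqVneq v w; last first.
    by left; apply: (gf_proj_orth gf) => wv'; apply: wv.
  right; rewrite (proj_idem gf); split; first by rewrite oner.
  move=> z f zf; have [hf _ _] := zf; rewrite -(star_homS hf) (proj_star gf).
  by rewrite expr0 scale1r (phase_rep_proj zf tw).
rewrite -[word _ _ (e :: al) _]/(s e ** word p s al v).
have [we|/eqP we] := eqVneq w (rng e); last first.
  by left; rewrite cmulA (proj_edge_neq finE gf we) cmul0l.
have ce : cyclic_vertex (rng e).
  by case: tw => [|sw]; [rewrite we | case: sw; exists e].
have ie := in_edge_rng noentry ce.
have tsrc : terminal_vertex (src e) by left; exact: cyclic_src.
have eX : p w ** (s e ** word p s al v) = s e ** (p (src e) ** word p s al v).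
  by rewrite we cmulA (proj_edge finE gf) [RHS]cmulA (edge_proj gf).
rewrite eX; have [->|[hU hz]] := IH _ tsrc; [by left; rewrite cmul0r | right]; split.
  rewrite hU upowS cmulA (edge_proj gf) [RHS]cmulA proj_shift.
  by rewrite /cycle_step we ie.
move=> z f zf; have [hf _ _] := zf.
rewrite (star_homM hf) cstarM bopME we (phase_rep_edge zf ce) bopfZ (hz _ _ zf).
by rewrite exprS scalerA.
Qed.

(** Compressions of the monomials to a terminal vertex w are Laurent polynomials
    in the shift along the cycles, and the coefficient of the phase
    representation at the vector of w is the value of that Laurent polynomial at
    the phase. *)
Definition laurent_corner w b : Prop :=
  exists d (q : {poly R[i]}), b = p w ** ((upw d)^# ** pev q) ** p w /\
  forall z f, `|z| = 1 -> phase_rep z f ->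
    hip (f b (vertex_vector w)) (vertex_vector w) * z ^+ d = q.[z].

Lemma conj_phase (z : R[i]) : `|z| = 1 -> z * Num.conj z = 1.
Proof. by move=> z1; rewrite -normCK z1 expr1n. Qed.

Lemma laurent_corner0 w : laurent_corner w 0.
Proof.
exists 0%N, 0; rewrite peval0 cmul0r cmul0r cmul0l; split=> // z f z1 [hf _ _].
by rewrite star_hom0 // hip0l mul0r horner0.
Qed.

Lemma laurent_corner_lin w k a b : laurent_corner w a -> laurent_corner w b ->
  laurent_corner w (k *: a + b).
Proof.
move=> [d1 [q1 [-> h1]]] [d2 [q2 [-> h2]]].
have shifted d m q : (upw (d + m))^# ** pev ('X^m * q) = (upw d)^# ** pev q.
  rewrite addnC upowD (pevalM shift_shift_star oneU) pevalXn cstarM -cmulA.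
  by rewrite (cmulA (upw m)^#) upow_star_upow (one_peval shift_shift_star oneU).
exists (d1 + d2)%N, (k *: ('X^d2 * q1) + 'X^d1 * q2); split.
  rewrite pevalD pevalZ cmulDr cmulZr shifted addnC shifted.
  by rewrite cmulDr cmulDl cmulZr cmulZl.
move=> z f z1 zf; have [hf _ _] := zf.
rewrite (star_homD hf) (star_homZ hf) bopDE bopZE hipDl hipZl exprD mulrDl.
rewrite hornerD hornerZ !hornerM !hornerXn -(h1 _ _ z1 zf) -(h2 _ _ z1 zf).
by congr (_ + _); [rewrite -!mulrA; congr (_ * _); ring | ring].
Qed.

Lemma laurent_corner_mono w al be v : terminal_vertex w ->
  laurent_corner w (p w ** (word p s al v ** (word p s be v)^#) ** p w).
Proof.
move=> tw.
have e : p w ** (word p s al v ** (word p s be v)^#) ** p w =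
    (p w ** word p s al v) ** (p w ** word p s be v)^#.
  by rewrite cstarM (proj_star gf) !cmulA.
rewrite e; have [->|[ha hza]] := word_corner al v tw.
  by rewrite cmul0l; exact: laurent_corner0.
have [->|[hb hzb]] := word_corner be v tw.
  by rewrite cstar0 cmul0r; exact: laurent_corner0.
exists (size be), 'X^(size al); split.
  rewrite pevalXn -upow_star_comm ha hb cstarM (proj_star gf).
  by rewrite !cmulA.
move=> z f z1 zf; have [hf _ _] := zf.
rewrite (star_homM hf) bopME (star_homS hf) bop_hip_star (hzb _ _ zf) (hza _ _ zf).
rewrite hipZl hipZr hip_norm norm_basis2 expr1n mulr1 rmorphXn /= conjCK hornerXn.
by rewrite mulrAC -exprMn [Num.conj z * z]mulrC conj_phase // expr1n mul1r.
Qed.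

Lemma laurent_corner_span w a : terminal_vertex w -> monomial_span p s a ->
  laurent_corner w (p w ** a ** p w).
Proof.
move=> tw; elim=> [|k al be v b _ IH].
  by rewrite cmul0r cmul0l; exact: laurent_corner0.
rewrite cmulDr cmulDl cmulZr cmulZl; apply: laurent_corner_lin => //.
exact: laurent_corner_mono.
Qed.

Lemma norm_proj_le1 w : `|p w| <= 1.
Proof. exact: norm_projection_le1 (gf_proj gf w). Qed.

Lemma norm_compress_le w a : `|p w ** a ** p w| <= `|a|.
Proof.
apply: le_trans (cnormM _ _) _; rewrite -[leRHS]mulr1 ler_pM ?norm_proj_le1 //.
by apply: le_trans (cnormM _ _) _; rewrite -[leRHS]mul1r ler_pM ?norm_proj_le1.
Qed.

Lemma laurent_corner_norm w b (M : R[i]) : 0 <= M -> laurent_corner w b ->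
  (forall z f, `|z| = 1 -> phase_rep z f ->
    `|hip (f b (vertex_vector w)) (vertex_vector w)| <= M) -> `|b| <= M.
Proof.
move=> M0 [d [q [-> hq]]] HM; apply: le_trans (norm_compress_le _ _) _.
apply: le_trans (cnormM _ _) _; rewrite -[leRHS]mul1r ler_pM //.
  by rewrite cnorm_cstar (norm_upow_le1 shift_star_shift shift_shift_star oneU).
apply: (norm_peval_circle shift_star_shift shift_shift_star oneU) => // z z1.
have [f zf] := phase_rep_exists z1.
by rewrite -(hq _ _ z1 zf) normrM normrX z1 expr1n mulr1 (HM _ _ z1 zf).
Qed.

(** On approximations of an element of the corner that all phase representations
    kill, the matrix coefficients are small, hence so are the norms. *)
Lemma phase_reps_separate a :
  (forall z f, `|z| = 1 -> phase_rep z f -> f a = 0) -> a = 0.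
Proof.
move=> H; apply: contrapT => a0.
have [c [w [tw cw ac]]] := walk_to_terminal finV finE gf (gc_generated hA) a0.
apply: ac; apply: cstar_mul_eq0; set x := a ** c; set b := _ ** _.
have xw : x ** p w = x by rewrite -cmulA cw.
have bw : p w ** b ** p w = b.
  have -> : p w ** b ** p w = (x ** p w)^# ** (x ** p w).
    by rewrite cstarM (proj_star gf) !cmulA.
  by rewrite xw.
have fb z f : `|z| = 1 -> phase_rep z f -> f b = 0.
  move=> z1 zf; have [hf _ _] := zf.
  by rewrite /b /x !(star_homM hf) (H _ _ z1 zf) cmul0l cmul0r.
apply: (@norm_small_eq0 _ _ 2) => // e e0.
have [d hd bd] := monomial_span_dense finV finE gf (gc_generated hA) b e0.
pose b1 := p w ** d ** p w.
have bb1 : `|b - b1| <= e.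
  rewrite -bw /b1 -cmulBl -cmulBr; exact: le_trans (norm_compress_le _ _) (ltW bd).
have b1e : `|b1| <= e.
  apply: (laurent_corner_norm (w := w)) => [||z f z1 zf]; first exact: ltW.
    exact: laurent_corner_span.
  have [hf _ _] := zf.
  have -> : f b1 = f (b1 - b) by rewrite (star_homB hf) (fb _ _ z1 zf) subr0.
  apply: le_trans (cauchy_schwarz _ _) _; rewrite norm_basis2 mulr1.
  apply: le_trans (bopN _ _) _; rewrite norm_basis2 mulr1.
  apply: le_trans (star_hom_contractive hf _) _; by rewrite distrC.
rewrite -(subrK b1 b); apply: le_trans (ler_normD _ _) _.
by rewrite mulr_natl mulr2n lerD.
Qed.

(** The condition holds on the generators and defines a closed subalgebra,
    because homomorphisms are contractive. *)
Lemma phase_rep_support N z f a x k : `|z| = 1 ->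
  (forall n v, nat_lab (@path_lab G) n v -> (n < N)%N) ->
  phase_rep z f -> (N <= k)%N -> bfun (f a) x k = 0.
Proof.
move=> z1 HN [hf fp fs] Nk.
have out v : ~ nat_lab (@path_lab G) k v by move=> /HN; rewrite ltnNge Nk.
suff full : [set a | (forall x, bfun (f a) x k = 0) /\
    forall x, bfun (f a^#) x k = 0] = setT.
  have [Ha _] : [set a | (forall x, bfun (f a) x k = 0) /\
    forall x, bfun (f a^#) x k = 0] a by rewrite full.
  exact: Ha.
apply: (gc_generated hA) => [|v|e]; last 2 first.
- rewrite /= (proj_star gf) fp; split=> {}x; rewrite diag_projE;
    case: pselect => // h; by case: (out v).
- rewrite /= (star_homS hf) fs cstarZ shift_star.
  split=> {}x; rewrite bopZE coordZ shiftE pull_out ?mulr0 // => j.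
    by move=> /(bs_rng bs); exact: out.
  by move=> h; apply: (out (src e)); apply/(bs_src bs); exists j.
split.
- by rewrite /= cstar0 (star_hom0 hf).
- move=> b c [b1 b2] [c1 c2]; rewrite /= cstarD cstarM !(star_homD hf) !(star_homM hf).
  split; split=> {}x; rewrite ?bopDE ?coordD ?bopME ?b1 ?c1 ?b2 ?c2 //; exact: addr0.
- move=> l b [b1 b2]; rewrite /= cstarZ !(star_homZ hf).
  by split=> {}x; rewrite bopZE coordZ ?b1 ?b2 mulr0.
- by move=> b [b1 b2]; rewrite /= cstarK.
apply: closed_approx => b Hb.
have lim (g : A -> A) : (forall c, `|g b - g c| <= `|b - c|) ->
    (forall c, [set a | (forall x, bfun (f a) x k = 0) /\
    forall x, bfun (f a^#) x k = 0] c -> forall x, bfun (f (g c)) x k = 0) ->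
    forall x, bfun (f (g b)) x k = 0.
  move=> gl gk {}x; apply: (@norm_small_eq0 R R[i]^o `|x|) => // e e0.
  have [c hc bc] := Hb e e0.
  have -> : bfun (f (g b)) x k = bfun (f (g b - g c)) x k.
    by rewrite (star_homB hf) bopBE coordB (gk _ hc) subr0.
  apply: le_trans (ell2_coord_norm _ _) _; apply: le_trans (bopN _ _) _.
  rewrite mulrC ler_wpM2l //; apply: le_trans (star_hom_contractive hf _) _.
  exact: le_trans (gl c) (ltW bc).
split.
- by apply: (lim id) => // c [].
- by apply: (lim (@cstar R A)) => [c|c []//]; rewrite -cstarB cnorm_cstar.
Qed.

Definition rep_matrix (N : nat) (f : A -> bop (ell2 R)) (a : A) : 'M[R[i]]_N :=
  \matrix_(i, j) (f a (basis2 R j)) i.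

Lemma rep_matrix_fin_dim N z f : `|z| = 1 ->
  (forall n v, nat_lab (@path_lab G) n v -> (n < N)%N) ->
  phase_rep z f -> fin_dim_rep (rep_matrix N f).
Proof.
move=> z1 HN zf; have [hf _ _] := zf; split.
- move=> k a b; apply/matrixP => i j.
  by rewrite !mxE (star_homD hf) (star_homZ hf) bopDE bopZE coordD coordZ.
- move=> a b; apply/matrixP => i j; rewrite !mxE (star_homM hf) bopME.
  have -> : f b (basis2 R j) = trunc2 N (f b (basis2 R j)).
    apply: ell2_ext => m; rewrite trunc2E; case: ltnP => // Nm.
    exact: phase_rep_support z1 HN zf Nm.
  rewrite /trunc2 (big_morph (f a) (@bopfD _ _ _) (@bopf0 _ _ _)) coord_sum.
  rewrite big_mkord; apply: eq_bigr => m _.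
  by rewrite bopfZ coordZ !mxE mulrC.
- move=> a; apply/matrixP => i j; rewrite !mxE (star_homS hf).
  by rewrite -[LHS]hip_basis2 hipC -bop_hip_star hip_basis2.
Qed.

Lemma rep_matrix_eq0 N z f a : `|z| = 1 ->
  (forall n v, nat_lab (@path_lab G) n v -> (n < N)%N) ->
  phase_rep z f -> rep_matrix N f a = 0 -> f a = 0.
Proof.
move=> z1 HN zf M0; have [hf _ _] := zf.
have star_coord i j : bfun (f a) (basis2 R j) i = Num.conj (bfun (f a^#) (basis2 R i) j).
  by rewrite -[LHS]hip_basis2 bop_hip_star basis2_hip (star_homS hf).
have entry0 i j : bfun (f a) (basis2 R j) i = 0.
  have [iN|Ni] := ltnP i N; last exact: phase_rep_support z1 HN zf Ni.
  have [jN|Nj] := ltnP j N.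
    by move/matrixP: M0 => /(_ (Ordinal iN) (Ordinal jN)); rewrite !mxE.
  by rewrite star_coord (phase_rep_support _ _ z1 HN zf Nj) rmorph0.
apply: bop_ext => x; apply: ell2_ext => i.
rewrite -hip_basis2 -(cstarK (f a)) -(star_homS hf).
have -> : bfun (f a^#)^# x = bfun (f a) x by rewrite (star_homS hf) cstarK.
rewrite bop_hip_star -(star_homS hf).
have -> : bfun (f a^#) (basis2 R i) = 0; last by rewrite hip0r.
apply: ell2_ext => j; have /eqP := entry0 i j; rewrite star_coord conjC_eq0.
by move/eqP.
Qed.

Lemma graph_conditions_rfd : residually_finite_dim A.
Proof.
have [N HN] := path_lab_bounded finV finE.
pose I := {x : R[i] * (A -> bop (ell2 R)) | `|x.1| = 1 /\ phase_rep x.1 x.2}.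
exists I, (fun=> N), (fun x : I => rep_matrix N (sval x).2); split.
  by case=> [[z f] /= [z1 zf]]; apply: rep_matrix_fin_dim z1 HN zf.
move=> a a0; apply: contrapT => /forallNP H; apply: a0.
apply: phase_reps_separate => z f z1 zf.
have := H (exist _ (z, f) (conj z1 zf)) => /contrapT /=.
exact: rep_matrix_eq0 z1 HN zf.
Qed.

End RationalCorners.

Theorem theorem4p4 (R : realType) (G : digraph) (A : cstarAlgType R)
    (p : vertex G -> A) (s : edge G -> A)
    (finV : finite_set [set: vertex G])
    (hA : is_graph_cstar p s) :
  residually_finite_dim A <-> finite_digraph G /\ no_cycle_has_entry G.
Proof.
split=> [rfd|[[_ finE] noentry]]; first exact: (rfd_graph_conditions finV hA rfd).
exact: (graph_conditions_rfd finV finE noentry hA).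
Qed.
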